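(* Let $E$ be a field of characteristic $p$. If $\mathrm{M}$ is a surjective $(\psi,\Gamma)$-module over $E[[X]]$ that is non-degenerate and free over $E[[X]]$, then there exists a $(\phi,\Gamma)$-module structure on $\mathrm{D}=E((X))\otimes_{E[[X]]}\mathrm{M}$ compatible with the $(\psi,\Gamma)$-module structure of $\mathrm{M}$.
   Context: $\Gamma=\mathbf{Z}_p^\times$ ($a$ written $[a]$) acts on $E[[X]]$, $E((X))$ by $([a]f)(X)=f((1+X)^a-1)$; $\phi(f)(X)=f(X^p)$. A $(\psi,\Gamma)$-module is a finitely generated $E[[X]]$-module $\mathrm{M}$ with an additive map $\psi:\mathrm{M}\to\mathrm{M}$ with $\psi(f(X^p)y)=f(X)\psi(y)$ and a continuous semilinear $\Gamma$-action commuting with $\psi$. It is surjective if $\psi$ is surjective, and non-degenerate if whenever $y\in\mathrm{M}$ satisfies $\psi(f(X)y)=0$ for all $f\in E[[X]]$, then $y=0$. A $(\phi,\Gamma)$-module is a finite-dimensional $E((X))$-vector space $\mathrm{D}$ with a $\phi$-semilinear $\phi:\mathrm{D}\to\mathrm{D}$ whose matrix in some basis is invertible and a continuous semilinear $\Gamma$-action commuting with $\phi$; it carries the operator $\psi$ defined by writing $y=\sum_{j=0}^{p-1}(1+X)^j\phi(y_j)$ uniquely and setting $\psi(y)=y_0$. Compatible means: the $\Gamma$-action on $\mathrm{D}$ extends that of $\mathrm{M}$, and the operator $\psi$ of $\mathrm{D}$ restricts to the given $\psi$ on $\mathrm{M}$. *)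

(* Defs.v *)
From HB Require Import structures.
From mathcomp Require Import all_boot all_algebra.
From mathcomp Require Import boolp classical_sets.

Set Implicit Arguments.
Unset Strict Implicit.
Unset Printing Implicit Defensive.

Import GRing.Theory.
Local Open Scope ring_scope.
Local Open Scope quotient_scope.

(* {fps E} is the ring E[[X]]; f i is the coefficient of X^i in f.            *)

Record fps (E : fieldType) := Fps {fps_coef :> nat -> E}.

Notation "{ 'fps' E }" := (fps E) (format "{ 'fps'  E }") : type_scope.

Section PowerSeries.
Variable E : fieldType.
Implicit Types f g h : {fps E}.

HB.instance Definition _ := gen_eqMixin {fps E}.
HB.instance Definition _ := gen_choiceMixin {fps E}.

Lemma fpsP f g : f =1 g -> f = g.
Proof. by case: f g => [f] [g] /= /funext ->. Qed.

Definition fps0 := Fps (fun _ => 0 : E).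
Definition fpsC (c : E) := Fps (fun i => if i == 0%N then c else 0).
Definition fps_add f g := Fps (fun i => f i + g i).
Definition fps_opp f := Fps (fun i => - f i).
Definition fps_mul f g := Fps (fun i => \sum_(j < i.+1) f j * g (i - j)%N).

Lemma fps_addA : associative fps_add.
Proof. by move=> f g h; apply: fpsP => i /=; rewrite addrA. Qed.
Lemma fps_addC : commutative fps_add.
Proof. by move=> f g; apply: fpsP => i /=; rewrite addrC. Qed.
Lemma fps_add0 : left_id fps0 fps_add.
Proof. by move=> f; apply: fpsP => i /=; rewrite add0r. Qed.
Lemma fps_addN : left_inverse fps0 fps_opp fps_add.
Proof. by move=> f; apply: fpsP => i /=; rewrite addNr. Qed.

HB.instance Definition _ :=
  GRing.isZmodule.Build {fps E} fps_addA fps_addC fps_add0 fps_addN.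

Let tr n f : {poly E} := \poly_(i < n) f i.

Let coef_tr_mul n f g i : (i < n)%N -> (tr n f * tr n g)`_i = fps_mul f g i.
Proof.
move=> lt_in; rewrite coefM /=; apply: eq_bigr => j _; rewrite !coef_poly.
have le_ji : (j <= i)%N by rewrite -ltnS.
by rewrite (leq_ltn_trans le_ji lt_in) (leq_ltn_trans (leq_subr _ _) lt_in).
Qed.

Let mulE f g i : fps_mul f g i = (tr i.+1 f * tr i.+1 g)`_i.
Proof. by rewrite coef_tr_mul. Qed.

Lemma fps_mulC : commutative fps_mul.
Proof. by move=> f g; apply: fpsP => i; rewrite !mulE mulrC. Qed.

Lemma fps_mulA : associative fps_mul.
Proof.
move=> f g h; apply: fpsP => i; rewrite !mulE.
have trM u v j : (j <= i)%N ->
    (tr i.+1 (fps_mul u v))`_j = (tr i.+1 u * tr i.+1 v)`_j.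
  by move=> le_ji; rewrite coef_tr_mul ?ltnS // coef_poly ltnS le_ji.
transitivity ((tr i.+1 f * (tr i.+1 g * tr i.+1 h))`_i).
  rewrite !(coefM (tr i.+1 f)); apply: eq_bigr => j _.
  by rewrite trM ?leq_subr.
rewrite mulrA !(coefM _ (tr i.+1 h)); apply: eq_bigr => j _.
by rewrite trM // -ltnS.
Qed.

Lemma fps_mul1 : left_id (fpsC 1) fps_mul.
Proof.
move=> f; apply: fpsP => i /=; rewrite big_ord_recl /= mul1r subn0 big1 ?addr0 //.
by move=> j _; rewrite mul0r.
Qed.

Lemma fps_mulDl : left_distributive fps_mul fps_add.
Proof.
move=> f g h; apply: fpsP => i /=; rewrite -big_split.
by apply: eq_bigr => j _; rewrite mulrDl.
Qed.

Lemma fps1_neq0 : fpsC 1 != 0.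
Proof. by apply/eqP => /(congr1 (fun f : {fps E} => f 0%N))/eqP; rewrite oner_eq0. Qed.

HB.instance Definition _ := GRing.Zmodule_isComNzRing.Build {fps E}
  fps_mulA fps_mulC fps_mul1 fps_mulDl fps1_neq0.

Definition fps_unit : pred {fps E} := fun f => `[<exists g, g * f = 1>].
Definition fps_inv f : {fps E} := xget f [set g | g * f = 1]%classic.

Lemma fps_mulV : {in fps_unit, left_inverse 1 fps_inv *%R}.
Proof. by move=> f /asboolP[g gf]; apply: (xgetI f (P := [set g | g * f = 1]%classic) gf). Qed.
Lemma fps_unitP f g : g * f = 1 -> fps_unit f.
Proof. by move=> gf; apply/asboolP; exists g. Qed.
Lemma fps_inv_out : {in [predC fps_unit], fps_inv =1 id}.
Proof.
move=> f /asboolP nf; rewrite /fps_inv; case: xgetP => // g _ gf.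
by case: nf; exists g.
Qed.

HB.instance Definition _ := GRing.ComNzRing_hasMulInverse.Build {fps E}
  fps_mulV fps_unitP fps_inv_out.

Lemma fps_neq0 f : f != 0 -> exists2 n, f n != 0 & forall i, (i < n)%N -> f i = 0.
Proof.
move=> fn0; have ex : exists n, f n != 0.
  apply: contrapT => nex; case/eqP: fn0; apply: fpsP => i /=.
  by apply/eqP; apply: contrapT => /negP nz; apply: nex; exists i.
exists (ex_minn ex); case: ex_minnP => // n _ nmin i.
by rewrite ltnNge; apply: contraNeq => /nmin.
Qed.

Lemma fps_mulf_eq0 f g : f * g = 0 -> (f == 0) || (g == 0).
Proof.
move=> fg0; apply: contrapT => /negP; rewrite negb_or => /andP[].
case/fps_neq0=> m fm fmin /fps_neq0[n gn gmin].
have /eqP : (f * g) (m + n)%N = 0 by rewrite fg0.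
have ltm : (m < (m + n).+1)%N by rewrite ltnS leq_addr.
rewrite /= (bigD1 (Ordinal ltm)) //= addKn big1 ?addr0 => [|j neq_jm].
  by rewrite mulf_eq0 (negPf fm) (negPf gn).
have : (j != m :> nat) by [].
rewrite neq_ltn => /orP[lt_jm|lt_mj]; first by rewrite fmin // mul0r.
have le_j : (j <= m + n)%N by rewrite -ltnS.
by rewrite gmin ?mulr0 // ltn_subLR // ltn_add2r.
Qed.

HB.instance Definition _ :=
  GRing.ComUnitRing_isIntegral.Build {fps E} fps_mulf_eq0.

Definition fpsX : {fps E} := Fps (fun i => (i == 1%N)%:R).

(* f(g(X)), meaningful when g has no constant term: the terms f_k g^k with    *)
(* k > i then do not contribute to the coefficient of X^i.                    *)
Definition fps_comp f g : {fps E} :=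
  Fps (fun i => \sum_(k < i.+1) f k * (g ^+ k) i).

End PowerSeries.

Arguments fpsX {E}.

Notation "x %:F" := (@FracField.tofrac _ x) : ring_scope.

(* E((X)) is the fraction field of E[[X]], with a : {fps E} embedded as a%:F. *)
Notation laurent E := {fraction {fps E}}.

(* The unique extension to Frac R of an injective ring endomorphism of R.     *)
Definition frac_ext (R : idomainType) (s : R -> R) (x : {fraction R}) :
  {fraction R} := (s \n_(repr x))%:F / (s \d_(repr x))%:F.

(* Z_p as the inverse limit of the Z/p^n: a n is the representative of a      *)
(* modulo p^n in [0, p^n).                                                    *)

Record Zp (p : nat) := MkZp {
  Zp_repr :> nat -> int;
  Zp_compat : forall n, (Zp_repr n.+1 %% (p ^ n)%N)%Z = Zp_repr n }.

Lemma modz_dvdm (m n d : int) : (d %| m)%Z -> ((n %% m)%Z = n %[mod d])%Z.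
Proof.
by case/dvdzP=> q ->; rewrite {2}(divz_eq n (q * d)) mulrA modzMDl.
Qed.

Section PadicIntegers.
Variable p : nat.
Implicit Types a b c : Zp p.

HB.instance Definition _ := gen_eqMixin (Zp p).
HB.instance Definition _ := gen_choiceMixin (Zp p).

Lemma ZpP a b : a =1 b -> a = b.
Proof.
case: a b => [a ca] [b cb] /= /funext eq_ab; case: b / eq_ab cb => cb.
by congr MkZp; apply: Prop_irrelevance.
Qed.

Lemma Zp_mod a n : (a n %% (p ^ n)%N)%Z = a n.
Proof. by rewrite -(Zp_compat a n) modz_mod. Qed.

Lemma Zp_of_subproof (u : nat -> int) :
  (forall n, (u n.+1 = u n %[mod (p ^ n)%N])%Z) ->
  forall n, ((u n.+1 %% (p ^ n.+1)%N)%Z %% (p ^ n)%N)%Z = (u n %% (p ^ n)%N)%Z.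
Proof.
move=> cu n; rewrite -(cu n); apply: modz_dvdm.
by rewrite expnS PoszM dvdz_mull.
Qed.

Definition Zp_of u cu := MkZp (@Zp_of_subproof u cu).

Lemma Zp_const_subproof (z : int) n : (z = z %[mod (p ^ n)%N])%Z.
Proof. by []. Qed.
Lemma Zp_add_subproof a b n :
  (a n.+1 + b n.+1 = a n + b n %[mod (p ^ n)%N])%Z.
Proof. by rewrite -modzDm !Zp_compat. Qed.
Lemma Zp_opp_subproof a n : (- a n.+1 = - a n %[mod (p ^ n)%N])%Z.
Proof. by rewrite -modzNm Zp_compat. Qed.
Lemma Zp_mul_subproof a b n :
  (a n.+1 * b n.+1 = a n * b n %[mod (p ^ n)%N])%Z.
Proof. by rewrite -modzMm !Zp_compat. Qed.

Definition Zp0 := Zp_of (Zp_const_subproof 0).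
Definition Zp1 := Zp_of (Zp_const_subproof 1).
Definition Zp_add a b := Zp_of (Zp_add_subproof a b).
Definition Zp_opp a := Zp_of (Zp_opp_subproof a).
Definition Zp_mul a b := Zp_of (Zp_mul_subproof a b).

Lemma Zp_addA : associative Zp_add.
Proof. by move=> a b c; apply: ZpP => n /=; rewrite modzDml modzDmr addrA. Qed.
Lemma Zp_addC : commutative Zp_add.
Proof. by move=> a b; apply: ZpP => n /=; rewrite addrC. Qed.
Lemma Zp_add0 : left_id Zp0 Zp_add.
Proof. by move=> a; apply: ZpP => n /=; rewrite modzDml add0r Zp_mod. Qed.
Lemma Zp_addN : left_inverse Zp0 Zp_opp Zp_add.
Proof. by move=> a; apply: ZpP => n /=; rewrite modzDml addNr. Qed.

HB.instance Definition _ :=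
  GRing.isZmodule.Build (Zp p) Zp_addA Zp_addC Zp_add0 Zp_addN.

Lemma Zp_mulA : associative Zp_mul.
Proof. by move=> a b c; apply: ZpP => n /=; rewrite modzMml modzMmr mulrA. Qed.
Lemma Zp_mulC : commutative Zp_mul.
Proof. by move=> a b; apply: ZpP => n /=; rewrite mulrC. Qed.
Lemma Zp_mul1 : left_id Zp1 Zp_mul.
Proof. by move=> a; apply: ZpP => n /=; rewrite modzMml mul1r Zp_mod. Qed.
Lemma Zp_mulDl : left_distributive Zp_mul Zp_add.
Proof.
move=> a b c; apply: ZpP => n /=.
by rewrite modzMml modzDm mulrDl.
Qed.

HB.instance Definition _ := GRing.Zmodule_isComPzRing.Build (Zp p)
  Zp_mulA Zp_mulC Zp_mul1 Zp_mulDl.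

End PadicIntegers.

Definition Gamma (p : nat) := {a : Zp p | `[<exists b, b * a = 1>]}.

Section UnitGroup.
Variable p : nat.
Implicit Types a b c : Gamma p.

HB.instance Definition _ := Choice.on (Gamma p).

Lemma Gamma1_subproof : `[<exists b : Zp p, b * 1 = 1>].
Proof. by apply/asboolP; exists 1; rewrite mul1r. Qed.

Lemma GammaM_subproof a b : `[<exists c : Zp p, c * (val a * val b) = 1>].
Proof.
case: a b => a /= /asboolP[a' ha] [b /= /asboolP[b' hb]]; apply/asboolP.
by exists (a' * b'); rewrite mulrACA ha hb mulr1.
Qed.

Definition Gamma_inv_val a : Zp p := xget 0 [set b | b * val a = 1]%classic.

Lemma Gamma_inv_valK a : Gamma_inv_val a * val a = 1.
Proof.
case: a => a ha; case/asboolP: (ha) => b hb.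
exact: (@xgetI _ 0 [set b | b * a = 1]%classic b hb).
Qed.

Lemma GammaV_subproof a : `[<exists b : Zp p, b * Gamma_inv_val a = 1>].
Proof. by apply/asboolP; exists (val a); rewrite mulrC Gamma_inv_valK. Qed.

Definition Gamma1 : Gamma p := exist _ 1 Gamma1_subproof.
Definition GammaM a b : Gamma p := exist _ (val a * val b) (GammaM_subproof a b).
Definition GammaV a : Gamma p := exist _ (Gamma_inv_val a) (GammaV_subproof a).

Lemma Gamma_mulA : associative GammaM.
Proof. by move=> a b c; apply: val_inj; rewrite /= mulrA. Qed.
Lemma Gamma_mul1 : left_id Gamma1 GammaM.
Proof. by move=> a; apply: val_inj; rewrite /= mul1r. Qed.
Lemma Gamma_1mul : right_id Gamma1 GammaM.
Proof. by move=> a; apply: val_inj; rewrite /= mulr1. Qed.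
Lemma Gamma_mulV : left_inverse Gamma1 GammaV GammaM.
Proof. by move=> a; apply: val_inj; rewrite /= Gamma_inv_valK. Qed.
Lemma Gamma_Vmul : right_inverse Gamma1 GammaV GammaM.
Proof. by move=> a; apply: val_inj; rewrite /= mulrC Gamma_inv_valK. Qed.

HB.instance Definition _ := isGroup.Build (Gamma p)
  Gamma_mulA Gamma_mul1 Gamma_1mul Gamma_mulV Gamma_Vmul.

End UnitGroup.

Section Operators.
Variables (E : fieldType) (p : nat).
Implicit Types (f : {fps E}) (a : Gamma p).

(* (1 + X)^a is the X-adic limit of the (1 + X)^(a n): in characteristic p    *)
(* the coefficient of X^i in (1 + X)^m only depends on m modulo p^n as soon   *)
(* as i < p^n, and i < p^i; see oneX_powE.                                    *)
Definition oneX_pow (a : Zp p) : {fps E} :=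
  Fps (fun i => ((1 + fpsX) ^+ `|a i|%N : {fps E}) i).

Lemma coef_Xn_mul q f i : (i < q)%N -> (fpsX ^+ q * f) i = 0.
Proof.
elim: q i => // q IH i lt_iq; rewrite exprS -mulrA; set g := _ ^+ q * f in IH *.
rewrite [LHS]big1 // => -[[|[|j]] ltj] _; rewrite [fpsX _]/= ?mul0r // mul1r.
rewrite [nat_of_ord _]/=; case: i lt_iq {ltj} (ltj : (1 < i.+1)%N) => // i lt_iq _.
by rewrite subn1 IH.
Qed.

Lemma oneX_powE (a : Zp p) n i : p \in [pchar E] -> (i < p ^ n)%N ->
  oneX_pow a i = ((1 + fpsX) ^+ `|a n|%N : {fps E}) i.
Proof.
move=> charE lt_i; have p_pr := pcharf_prime charE.
have pow_mod k m : (i < p ^ k)%N ->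
    ((1 + fpsX) ^+ m : {fps E}) i = ((1 + fpsX) ^+ (m %% p ^ k)%N : {fps E}) i.
  move=> lt_ik; rewrite {1}(divn_eq m (p ^ k)) exprD mulnC exprM.
  have charF : p \in [pchar {fps E}].
    rewrite inE p_pr /=; apply/eqP/fpsP => -[|j].
      rewrite -[RHS]/(0 : E) -(pcharf0 charE).
      by elim: (p) => // q IHq; rewrite !mulrS -IHq.
    rewrite -[RHS]/(0 : E).
    by elim: (p) => // q IHq; rewrite mulrS /= IHq add0r.
  have -> : (1 + fpsX) ^+ (p ^ k) = 1 + fpsX ^+ (p ^ k) :> {fps E}.
    by rewrite exprDn_pchar ?expr1n // pnatX pnatE // charF.
  have [g ->] : exists g : {fps E},
      (1 + fpsX ^+ (p ^ k)) ^+ (m %/ p ^ k) = 1 + fpsX ^+ (p ^ k) * g.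
    elim: (m %/ _)%N => [|j [g IHj]]; first by exists 0; rewrite mulr0 addr0.
    exists (g + (1 + fpsX ^+ (p ^ k) * g)); rewrite exprSr IHj.
    by rewrite mulrDr mulr1 mulrDr [X in _ + X]mulrC addrA.
  rewrite mulrDl mul1r -mulrA; set h : {fps E} := fpsX ^+ _ * _.
  by rewrite -[LHS]/(_ + h i) /h coef_Xn_mul ?addr0.
have abs_mod k l : (k <= l)%N -> (`|a l| %% p ^ k)%N = `|a k|%N.
  move=> le_kl; apply/eqP; rewrite -eqz_nat -modz_nat !gez0_abs; last first.
  - by rewrite -Zp_mod modz_ge0 // eqz_nat expn_eq0 negb_and -lt0n prime_gt0.
  - by rewrite -Zp_mod modz_ge0 // eqz_nat expn_eq0 negb_and -lt0n prime_gt0.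
  apply/eqP; rewrite -(subnKC le_kl); elim: (l - k)%N => [|j IHj].
    by rewrite addn0 Zp_mod.
  rewrite -IHj addnS -(Zp_compat a (k + j)).
  by rewrite modz_dvdm // expnD PoszM dvdz_mulr.
have lt_ii : (i < p ^ i)%N by rewrite ltn_expl // prime_gt1.
rewrite /=; have [le_in|lt_ni] := leqP i n.
  by rewrite [RHS](pow_mod i) // abs_mod.
by rewrite [LHS](pow_mod n) // abs_mod // ltnW.
Qed.

Definition phi_fps f : {fps E} := fps_comp f (fpsX ^+ p).
Definition gamma_fps a f : {fps E} := fps_comp f (oneX_pow (val a) - 1).

Definition phi_laurent : laurent E -> laurent E := frac_ext phi_fps.
Definition gamma_laurent a : laurent E -> laurent E := frac_ext (gamma_fps a).

End Operators.

(* The tensor product Frac R (x)_R M, as the quotient of the formal finite    *)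
(* sums of pairs (x, m) by the defining relations of a tensor product.        *)

Section BaseChange.
Variables (R : idomainType) (M : lmodType R).
Local Notation K := {fraction R}.
Implicit Types (s t u : seq (K * M)) (x y : K) (m n : M) (r : R).

Inductive tensor_eq : seq (K * M) -> seq (K * M) -> Prop :=
| Teq_refl s : tensor_eq s s
| Teq_sym s t : tensor_eq s t -> tensor_eq t s
| Teq_trans s t u : tensor_eq s t -> tensor_eq t u -> tensor_eq s u
| Teq_cat s s' t t' :
    tensor_eq s s' -> tensor_eq t t' -> tensor_eq (s ++ t) (s' ++ t')
| Teq_catC s t : tensor_eq (s ++ t) (t ++ s)
| Teq_zero m : tensor_eq [:: (0, m)] [::]
| Teq_addl x y m : tensor_eq [:: (x + y, m)] [:: (x, m); (y, m)]
| Teq_addr x m n : tensor_eq [:: (x, m + n)] [:: (x, m); (x, n)]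
| Teq_bal x r m : tensor_eq [:: (x * r%:F, m)] [:: (x, r *: m)].

Definition tensor_eqb s t := `[<tensor_eq s t>].

Lemma tensor_eqb_refl : reflexive tensor_eqb.
Proof. by move=> s; apply/asboolP; apply: Teq_refl. Qed.
Lemma tensor_eqb_sym : symmetric tensor_eqb.
Proof. by move=> s t; apply/asboolP/asboolP; apply: Teq_sym. Qed.
Lemma tensor_eqb_trans : transitive tensor_eqb.
Proof. by move=> t s u /asboolP st /asboolP tu; apply/asboolP; apply: Teq_trans tu. Qed.

Canonical tensor_equiv :=
  EquivRel tensor_eqb tensor_eqb_refl tensor_eqb_sym tensor_eqb_trans.

Definition base_change := {eq_quot tensor_equiv}.
HB.instance Definition _ := Choice.on base_change.
HB.instance Definition _ := EqQuotient.on base_change.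

Definition tensor x m : base_change := \pi_base_change [:: (x, m)].

Lemma tensor_piP s t : tensor_eq s t <-> \pi_base_change s = \pi_base_change t.
Proof. by split=> [?|/eqmodP/asboolP//]; apply/eqmodP/asboolP. Qed.

Lemma tensor_reprK s : tensor_eq (repr (\pi_base_change s)) s.
Proof. by apply/tensor_piP; rewrite reprK. Qed.

Definition scale_seq x s := [seq (x * v.1, v.2) | v : K * M <- s].

Lemma scale_seq_eq x s t :
  tensor_eq s t -> tensor_eq (scale_seq x s) (scale_seq x t).
Proof.
rewrite /scale_seq; elim=> {s t} /=.
- by move=> s; apply: Teq_refl.
- by move=> s t _; apply: Teq_sym.
- by move=> s t u _ st _; apply: Teq_trans.
- by move=> s s' t t' _ h _ h'; rewrite !map_cat; apply: Teq_cat.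
- by move=> s t; rewrite !map_cat; apply: Teq_catC.
- by move=> m; rewrite mulr0; apply: Teq_zero.
- by move=> y z m; rewrite mulrDr; apply: Teq_addl.
- by move=> y m n; apply: Teq_addr.
- by move=> y r m; rewrite mulrA; apply: Teq_bal.
Qed.

Lemma scale_seqDl x y s :
  tensor_eq (scale_seq (x + y) s) (scale_seq x s ++ scale_seq y s).
Proof.
elim: s => [|[z m] s IH]; first exact: Teq_refl.
rewrite [scale_seq _ _]/= mulrDl -/(scale_seq _ s) /= -/(scale_seq _ s) -/(scale_seq _ s).
move: (x * z) (y * z) (scale_seq (x + y) s) (scale_seq x s) (scale_seq y s) IH.
move=> a b s1 s2 s3 IH.
apply: Teq_trans (Teq_cat (Teq_addl a b m) IH) _.
apply: (Teq_cat (Teq_refl [:: (a, m)])).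
rewrite -(cat1s (b, m) s3) catA -[X in tensor_eq X]/(([:: (b, m)] ++ s2) ++ s3).
by apply: Teq_cat (Teq_catC _ _) (Teq_refl s3).
Qed.

Lemma scale_seq0 s : tensor_eq (scale_seq 0 s) [::].
Proof.
elim: s => [|[z m] s IH] /=; first exact: Teq_refl.
by rewrite mul0r -cat1s; apply: (Teq_cat (Teq_zero m) IH).
Qed.

Lemma scale_seq1 s : scale_seq 1 s = s.
Proof. by rewrite /scale_seq -[RHS]map_id; apply: eq_map => -[x m]; rewrite mul1r. Qed.

Lemma scale_seqA x y s : scale_seq x (scale_seq y s) = scale_seq (x * y) s.
Proof. by rewrite /scale_seq -map_comp; apply: eq_map => v /=; rewrite mulrA. Qed.

Definition tensor_zero : base_change := \pi_base_change [::].
Definition tensor_add (v w : base_change) : base_change :=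
  \pi_base_change (repr v ++ repr w).
Definition tensor_scale x (v : base_change) : base_change :=
  \pi_base_change (scale_seq x (repr v)).
Definition tensor_opp : base_change -> base_change := tensor_scale (-1).

Lemma pi_add s t :
  tensor_add (\pi_base_change s) (\pi_base_change t) = \pi_base_change (s ++ t).
Proof. by apply/tensor_piP/Teq_cat; apply: tensor_reprK. Qed.

Lemma pi_scale x s : tensor_scale x (\pi_base_change s) = \pi_base_change (scale_seq x s).
Proof. by apply/tensor_piP/scale_seq_eq/tensor_reprK. Qed.

Lemma tensor_addA : associative tensor_add.
Proof. move=> u v w; rewrite -[u]reprK -[v]reprK -[w]reprK.
move: (repr u) (repr v) (repr w) => {u v w} s t u.
by rewrite (pi_add s t) (pi_add t u) !pi_add catA. Qed.
Lemma tensor_addC : commutative tensor_add.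
Proof.
move=> v w; rewrite -[v]reprK -[w]reprK !pi_add.
exact/tensor_piP/Teq_catC.
Qed.
Lemma tensor_add0 : left_id tensor_zero tensor_add.
Proof. by move=> v; rewrite -[v]reprK pi_add. Qed.
Lemma tensor_addN : left_inverse tensor_zero tensor_opp tensor_add.
Proof.
move=> v; rewrite -[v]reprK /tensor_opp; move: (repr v) => s; rewrite pi_scale pi_add; apply/tensor_piP.
rewrite -{2}(scale_seq1 s); apply: Teq_trans (Teq_sym (scale_seqDl _ _ _)) _.
by rewrite addNr; apply: scale_seq0.
Qed.

HB.instance Definition _ := GRing.isZmodule.Build base_change
  tensor_addA tensor_addC tensor_add0 tensor_addN.

Lemma tensor_scaleA x y v :
  tensor_scale x (tensor_scale y v) = tensor_scale (x * y) v.
Proof. by rewrite -[v]reprK (pi_scale y) !pi_scale scale_seqA. Qed.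
Lemma tensor_scale1 : left_id 1 tensor_scale.
Proof. by move=> v; rewrite -[v]reprK pi_scale scale_seq1. Qed.
Lemma tensor_scaleDr : right_distributive tensor_scale +%R.
Proof.
move=> x v w; rewrite -[v]reprK -[w]reprK; move: (repr v) (repr w) => s t.
rewrite -[_ + _]/(tensor_add _ _) pi_add !pi_scale.
by rewrite -[RHS]/(tensor_add _ _) pi_add /scale_seq map_cat.
Qed.
Lemma tensor_scaleDl v : {morph tensor_scale^~ v : x y / x + y}.
Proof.
move=> x y; rewrite -[v]reprK; move: (repr v) => s; rewrite !pi_scale.
rewrite -[RHS]/(tensor_add _ _) pi_add.
exact/tensor_piP/scale_seqDl.
Qed.

HB.instance Definition _ := GRing.Zmodule_isLmodule.Build K base_change
  tensor_scaleA tensor_scale1 tensor_scaleDr tensor_scaleDl.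

End BaseChange.

Section ModuleNotions.
Variables (R : pzRingType) (V : lmodType R).

Definition is_basis (I : choiceType) (e : I -> V) :=
  (forall v, exists (s : seq I) (c : I -> R), v = \sum_(i <- s) c i *: e i) /\
  (forall (s : seq I) (c : I -> R), uniq s ->
     \sum_(i <- s) c i *: e i = 0 -> forall i, i \in s -> c i = 0).

Definition is_free := exists (I : choiceType) (e : I -> V), is_basis e.

Definition finitely_generated := exists (n : nat) (e : 'I_n -> V),
  forall v, exists c : 'I_n -> R, v = \sum_i c i *: e i.

Definition finite_dimensional := exists (n : nat) (e : 'I_n -> V), is_basis e.

Definition semilinear (s : R -> R) (f : V -> V) :=
  {morph f : v w / v + w} /\ forall c v, f (c *: v) = s c *: f v.

Definition semilinear_action (p : nat) (s : Gamma p -> R -> R)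
    (act : Gamma p -> V -> V) :=
  [/\ forall v, act 1%g v = v,
      forall a b v, act (a * b)%g v = act a (act b v) &
      forall a, semilinear (s a) (act a)].

(* Continuity of Gamma x V -> V, where Gamma has the p-adic topology and the  *)
(* additive group V has the topology with U 0, U 1, ... as a basis of         *)
(* neighbourhoods of 0.                                                       *)
Definition continuous_action (p : nat) (U : nat -> V -> Prop)
    (act : Gamma p -> V -> V) :=
  forall (a : Gamma p) (v : V) (N : nat), exists k j : nat,
  forall (b : Gamma p) (w : V),
    val b k = val a k -> U j (w - v) -> U N (act b w - act a v).

End ModuleNotions.

Arguments is_free {R} V.
Arguments finitely_generated {R} V.
Arguments finite_dimensional {R} V.

Section Modules.
Variables (E : fieldType) (p : nat).

Section PsiGamma.
Variable M : lmodType {fps E}.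
Implicit Types (psi : M -> M) (act : Gamma p -> M -> M).

(* The subgroup X^j M; these define the X-adic topology of M.                 *)
Definition Xadic (j : nat) (m : M) := exists m', m = fpsX ^+ j *: m'.

Record psiGamma_module psi act : Prop := {
  psiGamma_fg : finitely_generated M;
  psiGamma_psiD : {morph psi : y z / y + z};
  psiGamma_psiZ : forall f y, psi (phi_fps p f *: y) = f *: psi y;
  psiGamma_act : semilinear_action (@gamma_fps E p) act;
  psiGamma_cont : continuous_action Xadic act;
  psiGamma_comm : forall a y, psi (act a y) = act a (psi y) }.

Definition psi_surjective psi := forall z, exists y, psi y = z.

Definition psi_nondegenerate psi :=
  forall y, (forall f, psi (f *: y) = 0) -> y = 0.

End PsiGamma.

Section PhiGamma.
Variable D : lmodType (laurent E).
Implicit Types (phi : D -> D) (act : Gamma p -> D -> D).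

(* X^j times the E[[X]]-lattice spanned by e; when e is a basis of D over     *)
(* E((X)) these define the X-adic topology of D.                              *)
Definition lattice_nbhs n (e : 'I_n -> D) (j : nat) (v : D) :=
  exists c : 'I_n -> {fps E}, v = \sum_i (fpsX ^+ j * c i)%:F *: e i.

Definition matrix_of phi n (e : 'I_n -> D) (A : 'M[laurent E]_n) :=
  forall j, phi (e j) = \sum_i A i j *: e i.

Record phiGamma_module phi act : Prop := {
  phiGamma_fd : finite_dimensional D;
  phiGamma_phi : semilinear (@phi_laurent E p) phi;
  phiGamma_etale : exists (n : nat) (e : 'I_n -> D) (A : 'M[laurent E]_n),
    [/\ is_basis e, matrix_of phi e A & A \in unitmx];
  phiGamma_act : semilinear_action (@gamma_laurent E p) act;
  phiGamma_cont : forall (n : nat) (e : 'I_n -> D),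
    is_basis e -> continuous_action (lattice_nbhs e) act;
  phiGamma_comm : forall a y, phi (act a y) = act a (phi y) }.

(* psi(y) = y_0 where y = \sum_(j < p) (1 + X)^j phi(y_j); only the values    *)
(* ys 0, ..., ys (p - 1) of the sequence ys are relevant.                     *)
Definition psi_of phi (y : D) : D :=
  xget (fun=> 0) [set ys : nat -> D |
    y = \sum_(j < p) ((1 + fpsX) ^+ j)%:F *: phi (ys j)]%classic 0%N.

End PhiGamma.
End Modules.

(* Compatibility along y |-> 1 (x) y, M -> E((X)) (x) M.                      *)
Definition compatible (E : fieldType) (p : nat) (M : lmodType {fps E})
    (psi : M -> M) (act : Gamma p -> M -> M)
    (phiD : base_change M -> base_change M)
    (actD : Gamma p -> base_change M -> base_change M) :=
  (forall a y, actD a (tensor 1 y) = tensor 1 (act a y)) /\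
  (forall y, psi_of p phiD (tensor 1 y) = tensor 1 (psi y)).

(* Main.v *)
(* Put u = 1 + X and let T : M -> E[[X]] (x)_phi M be the map                 *)
(* T(y) = \sum_(j < p) u^j (x) psi(u^-j y). It is E[[X]]-linear (check this   *)
(* for scalars in phi(E[[X]]) and for u), and it is injective because psi is  *)
(* non-degenerate; both sides being free of the same rank, it becomes an      *)
(* isomorphism over E((X)), and phi(z) = T^-1(1 (x) z) is the desired         *)
(* Frobenius. By construction y = \sum_j u^j phi(psi(u^-j y)), so that psi is *)
(* the operator attached to phi. When m and w lie in M, phi(m) = w means that *)
(* psi(w) = m and psi(u^k w) = 0 for 0 < k < p; the action of Gamma preserves *)
(* this condition, since (1 + X)^a is a limit of powers of 1 + X of exponent  *)
(* prime to p. Hence phi commutes with Gamma.                                 *)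
From mathcomp Require Import all_boot all_algebra.
From mathcomp Require Import boolp classical_sets zify.
Require Import Defs.

Set Implicit Arguments.
Unset Strict Implicit.
Unset Printing Implicit Defensive.

Import GRing.Theory.
Local Open Scope ring_scope.

(** * Power series and the Frobenius substitution *)

(** Let u = 1 + X. A compatible phi must satisfy y = \sum_(j < p) u^(j-p) phi(psi(u^(p-j) y)) on M,
    and this determines its matrix: up to the factor u^p it is the inverse of the matrix of the map
    whose coordinates are [psi_coord]. That map is linear ([psi_coordZ]), and non-degeneracy makes
    it injective ([psi_coord_inj0]), so its square matrix is invertible over E((X)) ([psi_mx_unit]).
    With phi defined by [phi_mx], the formula holds ([psi_expansion]); since the expansion is unique
    ([bc_phi_uniq]), psi is the operator attached to phi ([psi_of_bc_phi]).

    For m and w in M, phi(m) = w is a condition on psi alone ([bc_phi_psi_lift]), and Gamma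
    preserves it ([psi_lift_act]); multiplying by a power of X reduces commutation on D to this case
    ([bc_phi_actC]). Continuity passes from M to D by clearing denominators ([bc_act_continuous]),
    because every basis of D gives a lattice commensurable with M. *)

Section PowerSeries.
Variable E : fieldType.
Implicit Types f g h : {fps E}.

Lemma fps_coefB f g i : (f - g) i = f i - g i.
Proof. by []. Qed.

Lemma fps_coef_sum (I : Type) (s : seq I) (P : pred I) (F : I -> {fps E}) i :
  (\sum_(k <- s | P k) F k) i = \sum_(k <- s | P k) F k i.
Proof. by elim/big_rec2: _ => // k y x _ <-. Qed.

Lemma fps_coefM f g i : (f * g) i = \sum_(j < i.+1) f j * g (i - j)%N.
Proof. by []. Qed.

Lemma fps_coef0M f g : (f * g) 0%N = f 0%N * g 0%N.
Proof. by rewrite [LHS]/= big_ord1 subn0. Qed.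

Lemma fps_coefXnM n f i : (fpsX ^+ n * f) i = if (i < n)%N then 0 else f (i - n)%N.
Proof.
have [/coef_Xn_mul //|le_ni] := ltnP i n.
rewrite -{1}(subnKC le_ni); move: (i - n)%N => {le_ni} {}i.
elim: n i => [|n IH] i; first by rewrite mul1r.
rewrite exprS -mulrA addSn; move: (_ ^+ n * f) IH => g IH.
rewrite [LHS]/= big_ord_recl mul0r add0r big_ord_recl /= mul1r subn1 /=.
by rewrite big1 ?addr0 ?IH // => j _; rewrite mul0r.
Qed.

Lemma fps_coefXn n i : ((fpsX ^+ n : {fps E}) i) = (i == n)%:R.
Proof.
rewrite -(mulr1 (fpsX ^+ n)) fps_coefXnM.
have [lt_in|le_ni] := ltnP i n; first by rewrite ltn_eqF.
by rewrite /= subn_eq0 eqn_leq le_ni andbT; case: leqP.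
Qed.

Lemma fpsX_neq0 : fpsX != 0 :> {fps E}.
Proof. by apply/eqP => /(congr1 (fun f : {fps E} => f 1%N))/eqP; rewrite oner_eq0. Qed.

Lemma fps_oneX_neq0 : 1 + fpsX != 0 :> {fps E}.
Proof.
by apply/eqP => /(congr1 (fun f : {fps E} => f 0%N))/eqP; rewrite /= addr0 oner_eq0.
Qed.

Lemma fps_dvdXn n f : (forall i, (i < n)%N -> f i = 0) -> exists g, f = fpsX ^+ n * g.
Proof.
move=> f0; exists (Fps (fun i => f (n + i)%N)); apply: fpsP => i.
by rewrite fps_coefXnM; case: ltnP => [/f0 //|le_ni]; rewrite /= subnKC.
Qed.

Lemma fps_dvdXn_eq0 f : (forall n, exists g, f = fpsX ^+ n * g) -> f = 0.
Proof.
move=> dvf; apply: fpsP => i; have [g ->] := dvf i.+1.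
by rewrite coef_Xn_mul.
Qed.

(** Geometric series: after scaling the constant term to 1, c f = 1 - X h, with inverse \sum_k (X
    h)^k. *)
Lemma fps_unit_coef0 f : f 0%N != 0 -> f \is a GRing.unit.
Proof.
move=> f0; pose c := fpsC (f 0%N)^-1.
have cf0 : (c * f) 0%N = 1 by rewrite fps_coef0M /= mulVf.
have [h fh] : exists h, 1 - c * f = fpsX ^+ 1 * h.
  by apply: fps_dvdXn => -[|//] _; rewrite fps_coefB cf0 subrr.
pose s n : {fps E} := \sum_(k < n) (fpsX * h) ^+ k.
have sE n : c * f * s n = 1 - fpsX ^+ n * h ^+ n.
  have -> : c * f = 1 - fpsX * h by rewrite -[fpsX]expr1 -fh subKr.
  by rewrite -exprMn -[in RHS](opprB _ 1) subrX1 -[in RHS]mulNr opprB.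
(* The infinite sum, read diagonally: the terms with k > i do not reach the coefficient of X^i. *)
pose g : {fps E} := Fps (fun i => s i.+1 i).
have gs n i : (i < n)%N -> g i = s n i.
  move=> lt_in; rewrite /g /= /s !fps_coef_sum -(subnKC lt_in) big_split_ord /=.
  rewrite [X in _ = _ + X]big1 ?addr0 // => k _.
  by rewrite exprMn coef_Xn_mul // ltnS leq_addr.
suff gE : g * c * f = 1 by apply/unitrPr; exists (g * c); rewrite mulrC.
rewrite -mulrA mulrC; apply: fpsP => i.
have -> : (c * f * g) i = (c * f * s i.+1) i.
  rewrite !fps_coefM; apply: eq_bigr => j _.
  by rewrite (gs i.+1) // ltnS leq_subr.
by rewrite sE fps_coefB coef_Xn_mul ?subr0.
Qed.

Lemma fps_split f : f != 0 ->
  exists n g, g \is a GRing.unit /\ f = fpsX ^+ n * g.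
Proof.
move=> /fps_neq0[n fn /fps_dvdXn[g fE]]; exists n, g; split=> //.
by apply: fps_unit_coef0; rewrite fE fps_coefXnM ltnn subnn in fn.
Qed.

Section Frobenius.
Variable p : nat.
Hypothesis charE : p \in [pchar E].
Local Notation phi := (@phi_fps E p).
Local Notation u := (1 + fpsX : {fps E}).

Let p_prime : prime p := pcharf_prime charE.
Let p_gt0 : (0 < p)%N := prime_gt0 p_prime.

Lemma pchar_fps : p \in [pchar {fps E}].
Proof.
rewrite inE p_prime; apply/eqP/fpsP => i.
have coefMn (f : {fps E}) m : (f *+ m) i = f i *+ m.
  by elim: m => // m IH; rewrite !mulrS -IH.
by rewrite coefMn -mulr_natr pcharf0 // mulr0.
Qed.

Lemma phi_coef f i : phi f i = if (p %| i)%N then f (i %/ p)%N else 0.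
Proof.
rewrite /= (eq_bigr (fun k : 'I_i.+1 => f k * (i == p * k)%N%:R)); last first.
  by move=> k _; rewrite -exprM fps_coefXn.
case: (boolP (p %| i)%N) => [/dvdnP[q ->]|ndv]; last first.
  rewrite big1 // => k _; case: eqP => [ei|]; last by rewrite mulr0.
  by rewrite ei dvdn_mulr in ndv.
have lt_q : (q < (q * p).+1)%N by rewrite ltnS leq_pmulr.
rewrite (bigD1 (Ordinal lt_q)) //= (mulnC p) eqxx mulr1 mulnK // big1 ?addr0 // => k.
by rewrite -val_eqE /= (mulnC p) eqn_pmul2r // eq_sym => /negPf ->; rewrite mulr0.
Qed.

Lemma phi_add : {morph phi : f g / f + g}.
Proof.
move=> f g; apply: fpsP => i; rewrite -[RHS]/(phi f i + phi g i) !phi_coef.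
by case: ifP => // _; rewrite addr0.
Qed.

Lemma phi_inj0 f : phi f = 0 -> f = 0.
Proof.
move=> f0; apply: fpsP => i; have /(congr1 (fun h : {fps E} => h (p * i)%N)) := f0.
by rewrite phi_coef dvdn_mulr // mulKn.
Qed.

Lemma phi_X : phi fpsX = fpsX ^+ p.
Proof.
apply: fpsP => i; rewrite phi_coef fps_coefXn; case: ifP => [/dvdnP[q ->]|ndv].
  by rewrite mulnK //= -{2}[p]mul1n eqn_pmul2r.
by case: eqP => // ei; rewrite ei dvdnn in ndv.
Qed.

Lemma phi_1 : phi 1 = 1.
Proof.
apply: fpsP => -[|i]; rewrite phi_coef ?dvdn0 ?div0n //.
by case: ifP => // /dvdnP[[|q] // ei]; rewrite [in LHS]ei mulnK.
Qed.

Lemma phi_oneX : phi u = u ^+ p.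
Proof. by rewrite phi_add phi_1 phi_X exprDn_pchar ?expr1n // pnatE // pchar_fps. Qed.

(** Euclidean division of i by p: only the summand with l = i mod p contributes to X^i. Hence 1, X,
    ..., X^(p-1) is a basis of E[[X]] over the image of phi. *)
Lemma sum_Xphi_coef (h : 'I_p -> {fps E}) i :
  (\sum_(l < p) fpsX ^+ l * phi (h l)) i = h (Ordinal (ltn_pmod i p_gt0)) (i %/ p)%N.
Proof.
rewrite fps_coef_sum; set r := Ordinal _.
rewrite (bigD1 r) // big1 => [|l neq_lr]; [rewrite [LHS]addr0|].
  have rE : r = (i %% p)%N :> nat by [].
  rewrite fps_coefXnM rE; case: ltnP => [|_]; first by rewrite ltnNge leq_mod.
  have -> : (i - i %% p = i %/ p * p)%N by rewrite {1}(divn_eq i p) addnK.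
  by rewrite phi_coef dvdn_mull // mulnK.
rewrite fps_coefXnM; case: ltnP => // le_li; rewrite phi_coef; case: ifP => // dv.
case/eqP: neq_lr; apply: val_inj => /=.
by rewrite -(subnK le_li) -modnDml (eqP dv) add0n modn_small.
Qed.

Lemma fps_Xphi_decomp f :
  exists h : 'I_p -> {fps E}, f = \sum_(l < p) fpsX ^+ l * phi (h l).
Proof.
exists (fun l => Fps (fun n => f (n * p + l)%N)); apply: fpsP => i.
by rewrite sum_Xphi_coef /= -divn_eq.
Qed.

Lemma sum_Xphi_eq0 (h : 'I_p -> {fps E}) :
  \sum_(l < p) fpsX ^+ l * phi (h l) = 0 -> forall l, h l = 0.
Proof.
move=> h0 l; apply: fpsP => i.
have /(congr1 (fun f : {fps E} => f (i * p + l)%N)) := h0; rewrite sum_Xphi_coef.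
have -> : Ordinal (ltn_pmod (i * p + l) p_gt0) = l.
  by apply: val_inj; rewrite /= modnMDl modn_small.
by rewrite divnMDl // divn_small // addn0.
Qed.

(* Expanding the powers of 1 + X in powers of X gives a unitriangular system  *)
(* with binomial coefficients, solved from the top index down.                *)
Lemma sum_oneX_phi_eq0 (h : 'I_p -> {fps E}) :
  \sum_(j < p) u ^+ j * phi (h j) = 0 -> forall j, h j = 0.
Proof.
have phiMn f m : phi (f *+ m) = phi f *+ m.
  elim: m => [|m IH]; last by rewrite !mulrS phi_add IH.
  by apply: (@addrI _ (phi 0)); rewrite mulr0n -phi_add !addr0.
have phi_sum (F : 'I_p -> {fps E}) : phi (\sum_j F j) = \sum_j phi (F j).
  by apply: (big_morph phi phi_add); apply: (phiMn 0 0%N).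
have uE (j : 'I_p) : u ^+ j = \sum_(l < p) fpsX ^+ l *+ 'C(j, l).
  rewrite exprDn.
  rewrite (big_ord_widen p (fun l => 1 ^+ (j - l) * fpsX ^+ l *+ 'C(j, l))) //.
  rewrite big_mkcond; apply: eq_bigr => l _; rewrite expr1n mul1r.
  by case: ltnP => [//|lt_jl]; rewrite bin_small.
move=> h0; have tri (l : 'I_p) : \sum_(j < p) h j *+ 'C(j, l) = 0.
  move: l; apply: sum_Xphi_eq0; rewrite -[RHS]h0.
  under eq_bigr => l _ do rewrite phi_sum mulr_sumr.
  rewrite exchange_big; apply: eq_bigr => j _.
  rewrite uE mulr_suml; apply: eq_bigr => l _.
  by rewrite phiMn mulrnAr mulrnAl.
suff top k (j : 'I_p) : (p - k <= j)%N -> h j = 0.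
  by move=> j; apply: (top p); rewrite subnn.
elim: k j => [|k IH] j; first by rewrite subn0 leqNgt ltn_ord.
move=> le_j; rewrite -[RHS](tri j) (bigD1 j) //= binn big1 ?addr0 // => i neq_ij.
have [lt_ij|lt_ji|eq_ij] := ltngtP i j; first by rewrite bin_small.
  by rewrite IH ?mul0rn //; lia.
by rewrite (val_inj eq_ij) eqxx in neq_ij.
Qed.

End Frobenius.
End PowerSeries.
(** * Fraction fields and base change *)

Section Embeddings.
Variables R S : nzRingType.

(** A predicate on bare functions, because the multiplicativity of [phi_fps] and [gamma_fps] is only
    deduced later, from their effect on M. *)
Definition embedding (s : R -> S) := [/\ {morph s : x y / x + y},
  {morph s : x y / x * y}, s 1 = 1 & forall x, s x = 0 -> x = 0].

Variable s : R -> S.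
Hypothesis s_emb : embedding s.

Lemma embeddingD : {morph s : x y / x + y}. Proof. by case: s_emb. Qed.
Lemma embeddingM : {morph s : x y / x * y}. Proof. by case: s_emb. Qed.
Lemma embedding1 : s 1 = 1. Proof. by case: s_emb. Qed.
Lemma embedding_inj0 x : s x = 0 -> x = 0. Proof. by case: s_emb => _ _ _; apply. Qed.

Lemma embedding0 : s 0 = 0.
Proof. by apply: (@addrI _ (s 0)); rewrite -embeddingD !addr0. Qed.

Lemma embedding_neq0 x : x != 0 -> s x != 0.
Proof. by apply: contraNneq => /embedding_inj0 ->. Qed.

Lemma embeddingX x n : s (x ^+ n) = s x ^+ n.
Proof. by elim: n => [|n IH]; rewrite ?embedding1 // !exprS embeddingM IH. Qed.

End Embeddings.

Section Fractions.
Variable R : idomainType.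
Local Notation K := {fraction R}.

Lemma frac_reprE (x : K) : x = (\n_(repr x))%:F / (\d_(repr x))%:F.
Proof.
have dn0 : (\d_(repr x))%:F != 0 :> K by rewrite tofrac_eq0 denom_ratioP.
apply: (mulIf dn0); rewrite mulfVK // -{1}[x]reprK.
move: (repr x) => {dn0 x} y; rewrite /GRing.mul /= !piE; apply/eqmodP.
rewrite /= FracField.equivfE /FracField.mulf.
rewrite !numden_Ratio ?mulf_neq0 ?oner_eq0 ?denom_ratioP //.
by rewrite !mulr1 mulrC.
Qed.

Lemma fraction_split (x : K) : exists n d, d != 0 /\ x = n%:F / d%:F.
Proof.
exists (\n_(repr x)), (\d_(repr x)).
by split; [apply: denom_ratioP|apply: frac_reprE].
Qed.

Lemma common_denominator n (x : 'I_n -> K) :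
  exists d, d != 0 /\ exists y : 'I_n -> R, forall i, d%:F * x i = (y i)%:F.
Proof.
pose d i := \d_(repr (x i)).
exists (\prod_i d i); split; first by apply/prodf_neq0 => i _; apply: denom_ratioP.
exists (fun i => (\prod_(j | j != i) d j) * \n_(repr (x i))) => i.
rewrite {1}(frac_reprE (x i)) -/(d i) (bigD1 i) //= !rmorphM /=.
have dn0 : (d i)%:F != 0 :> K by rewrite tofrac_eq0 denom_ratioP.
by rewrite [_ / _]mulrC mulrACA divff // mul1r.
Qed.

Section Extension.
Variable s : R -> R.
Hypothesis s_emb : embedding s.

(** Independence of the chosen representative, by cross-multiplication. *)
Lemma frac_extE n d : d != 0 -> frac_ext s (n%:F / d%:F) = (s n)%:F / (s d)%:F.
Proof.
move=> d0; set x := _ / _; rewrite /frac_ext.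
have := frac_reprE x; set n' := \n__; set d' := \d__ => xE.
have d'0 : d' != 0 by apply: denom_ratioP.
have sF0 e : e != 0 -> (s e)%:F != 0 :> K.
  by move=> e0; rewrite tofrac_eq0 (embedding_neq0 s_emb).
apply/eqP; rewrite eqr_div ?sF0 // -!rmorphM tofrac_eq -!(embeddingM s_emb).
apply/eqP; congr s; apply/eqP; rewrite -tofrac_eq !rmorphM /=.
by rewrite -eqr_div ?tofrac_eq0 // -xE.
Qed.

Lemma frac_ext_tofrac r : frac_ext s r%:F = (s r)%:F.
Proof.
have := @frac_extE r 1 (oner_neq0 _).
by rewrite (embedding1 s_emb) tofrac1 !divr1.
Qed.

Lemma frac_ext_embedding : embedding (frac_ext s).
Proof.
have sF0 e : e != 0 -> (s e)%:F != 0 :> K.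
  by move=> e0; rewrite tofrac_eq0 (embedding_neq0 s_emb).
split.
- move=> x y; have [n [d [d0 ->]]] := fraction_split x.
  have [m [e [e0 ->]]] := fraction_split y.
  rewrite addf_div ?tofrac_eq0 // -!rmorphM -rmorphD !frac_extE ?mulf_neq0 //.
  by rewrite addf_div ?sF0 // (embeddingD s_emb) !(embeddingM s_emb) rmorphD !rmorphM.
- move=> x y; have [n [d [d0 ->]]] := fraction_split x.
  have [m [e [e0 ->]]] := fraction_split y.
  rewrite mulf_div -!rmorphM !frac_extE ?mulf_neq0 //.
  by rewrite mulf_div !(embeddingM s_emb) !rmorphM.
- by rewrite -[1]/(1%:F) frac_ext_tofrac (embedding1 s_emb).
- move=> x; have [n [d [d0 ->]]] := fraction_split x.
  rewrite frac_extE // => /eqP; rewrite mulf_eq0 invr_eq0 (negPf (sF0 d d0)) orbF.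
  by rewrite tofrac_eq0 => /eqP /(embedding_inj0 s_emb) ->; rewrite mul0r.
Qed.

End Extension.

Lemma frac_ext_comp (s t v w : R -> R) :
    embedding s -> embedding t -> embedding v -> embedding w ->
    (forall r, s (t r) = v (w r)) ->
  forall x, frac_ext s (frac_ext t x) = frac_ext v (frac_ext w x).
Proof.
move=> es et ev ew st x; have [n [d [d0 ->]]] := fraction_split x.
by rewrite !frac_extE ?st // (embedding_neq0 et, embedding_neq0 ew).
Qed.

End Fractions.

Section BaseChange.
Variables (R : idomainType) (M : lmodType R).
Local Notation K := {fraction R}.
Local Notation D := (base_change M).

Lemma tensorE x (m : M) : tensor x m = x *: tensor 1 m.
Proof. by rewrite /GRing.scale /= /tensor pi_scale /= mulr1. Qed.

Lemma tensorDr x : {morph @tensor R M x : m n / m + n}.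
Proof.
move=> m n; rewrite /GRing.add /= /tensor pi_add.
exact/tensor_piP/Teq_addr.
Qed.

Lemma tensorZr (r : R) (m : M) : tensor 1 (r *: m) = r%:F *: tensor 1 m.
Proof.
rewrite -tensorE -[in RHS](mul1r r%:F); apply/tensor_piP.
exact/Teq_sym/Teq_bal.
Qed.

Lemma tensor0r x : tensor x 0 = 0 :> D.
Proof. by apply: (@addrI _ (tensor x 0)); rewrite -tensorDr !addr0. Qed.

Lemma tensorBr x (m n : M) : tensor x (m - n) = tensor x m - tensor x n.
Proof. by apply/eqP; rewrite eq_sym subr_eq -tensorDr subrK. Qed.

Lemma tensor_sum (I : Type) (s : seq I) (P : pred I) (F : I -> M) x :
  tensor x (\sum_(i <- s | P i) F i) = \sum_(i <- s | P i) tensor x (F i).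
Proof. exact: (big_morph (tensor x) (tensorDr x) (tensor0r x)). Qed.

Lemma base_change_ind (P : D -> Prop) :
    P 0 -> (forall v w, P v -> P w -> P (v + w)) -> (forall x m, P (tensor x m)) ->
  forall v, P v.
Proof.
move=> P0 PD PT v; rewrite -[v]reprK; elim: (repr v) => [|[x m] s IH]; first exact: P0.
by rewrite -cat1s -pi_add; apply: (PD _ _ (PT x m) IH).
Qed.

(* These forms separate the classes of the quotient defining [base_change].   *)
Section Lift.
Variable f : M -> R.
Hypothesis fD : {morph f : m n / m + n}.
Hypothesis fZ : forall r m, f (r *: m) = r * f m.

Definition bc_form (v : D) : K := \sum_(w <- repr v) w.1 * (f w.2)%:F.

(** The sum respects each defining relation of [tensor_eq], so any representative computes it. *)
Let formE s : bc_form (\pi_D s)%qT = \sum_(w <- s) w.1 * (f w.2)%:F.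
Proof.
suff eqf t t' : tensor_eq t t' ->
    \sum_(w <- t) w.1 * (f w.2)%:F = \sum_(w <- t') w.1 * (f w.2)%:F.
  exact/eqf/tensor_reprK.
elim=> {t t'} //=.
- by move=> t t' t'' _ -> _ ->.
- by move=> t t' v v' _ IH _ IH'; rewrite !big_cat /= IH IH'.
- by move=> t t'; rewrite !big_cat; apply: addrC.
- by move=> m; rewrite big_seq1 big_nil mul0r.
- by move=> x y m; rewrite !big_cons !big_nil !addr0 mulrDl.
- by move=> x m n; rewrite !big_cons !big_nil !addr0 /= fD rmorphD mulrDr.
- by move=> x r m; rewrite !big_seq1 /= fZ rmorphM mulrA.
Qed.

Lemma bc_form_tensor x m : bc_form (tensor x m) = x * (f m)%:F.
Proof. by rewrite formE big_seq1. Qed.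

Lemma bc_formD : {morph bc_form : v w / v + w}.
Proof.
move=> v w; rewrite -[v]reprK -[w]reprK.
by move: (repr v) (repr w) => s t; rewrite [in LHS]/GRing.add /= pi_add !formE big_cat.
Qed.

Lemma bc_formZ x v : bc_form (x *: v) = x * bc_form v.
Proof.
elim/base_change_ind: v => [|v w IHv IHw|y m].
- have f0 : bc_form 0 = 0 by apply: (etrans (formE [::])); rewrite big_nil.
  by rewrite scaler0 f0 mulr0.
- by rewrite scalerDr !bc_formD IHv IHw mulrDr.
- by rewrite [tensor y m in LHS]tensorE scalerA -tensorE !bc_form_tensor mulrA.
Qed.

End Lift.
End BaseChange.
(** * Coordinates and semilinear maps *)

Section Coordinates.
Variables (R : comNzRingType) (V : lmodType R).

Definition coordinates n (e : 'I_n -> V) (c : V -> 'I_n -> R) :=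
  (forall v, v = \sum_i c v i *: e i) /\ (forall a, c (\sum_i a i *: e i) =1 a).

(** Coefficients of repeated indices in [s] are added up, and indices of [S] outside [s] get 0. *)
Lemma seq_span (I : eqType) (e : I -> V) (S s : seq I) (c : I -> R) :
    uniq S -> {subset s <= S} ->
  exists a : I -> R, \sum_(i <- s) c i *: e i = \sum_(i <- S) a i *: e i.
Proof.
move=> uS; elim: s => [|x s IH] sS.
  by exists (fun=> 0); rewrite big_nil big1 // => i _; rewrite scale0r.
have [a aE] : exists a : I -> R, \sum_(i <- s) c i *: e i = \sum_(i <- S) a i *: e i.
  by apply: IH => i i_s; apply: sS; rewrite inE i_s orbT.
exists (fun i => (if i == x then c x else 0) + a i); rewrite big_cons aE.
under [RHS]eq_bigr => i _ do rewrite scalerDl.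
rewrite big_split /=; congr (_ + _).
rewrite (bigD1_seq x) ?sS ?mem_head //= eqxx big1 ?addr0 // => i /negPf ->.
by rewrite scale0r.
Qed.

Lemma is_basis_coordinates n (e : 'I_n -> V) : is_basis e <-> exists c, coordinates e c.
Proof.
split=> [[span indep]|[c [cE cK]]]; last first.
  split=> [v|s a us a0 i i_s]; first by exists (index_enum 'I_n), (c v).
  (* A relation supported on [s] becomes a relation over all indices once extended by zero. *)
  suff aE : \sum_(j < n) (if j \in s then a j else 0) *: e j = 0.
    have := cK (fun j => if j \in s then a j else 0) i.
    rewrite aE i_s => <-; have c0 := cK (fun=> 0) i.
    by rewrite big1 // in c0 => j _; rewrite scale0r.
  rewrite -[RHS]a0 [RHS]big_uniq // [RHS]big_mkcond /=; apply: eq_bigr => j _.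
  by case: ifP => // _; rewrite scale0r.
have /choice[c cE] v : exists a : 'I_n -> R, v = \sum_i a i *: e i.
  have [s [a ->]] := span v.
  by apply: seq_span (index_enum_uniq _) _ => i _; apply: mem_index_enum.
exists c; split=> // a i; apply/eqP; rewrite -subr_eq0; apply/eqP.
apply: (indep (index_enum 'I_n) (fun i => c _ i - a i) (index_enum_uniq _)).
  under eq_bigr => j _ do rewrite scalerBl.
  by rewrite sumrB -cE subrr.
exact: mem_index_enum.
Qed.

(** Expanding finitely many generators involves only finitely many basis vectors; these already span
    V and remain independent. *)
Lemma free_coordinates : is_free V -> finitely_generated V ->
  exists n (e : 'I_n -> V) c, coordinates e c.
Proof.
move=> [I [e [span indep]]] [m [g gE]].
have /choice[s /choice[a aE]] k : exists s (a : I -> R), g k = \sum_(i <- s) a i *: e i.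
  exact: span.
pose S := undup (flatten [seq s k | k <- enum 'I_m]).
have uS : uniq S := undup_uniq _.
exists (size S), (e \o tnth (in_tuple S)).
apply/is_basis_coordinates; split=> [v|t b ut b0 i i_t].
  have /choice[a' a'E] k : exists a', g k = \sum_(i <- S) a' i *: e i.
    rewrite aE; apply: seq_span => // i i_sk; rewrite mem_undup.
    by apply/flattenP; exists (s k) => //; apply: map_f; rewrite mem_enum.
  have [d ->] := gE v; exists (index_enum 'I_(size S)).
  exists (fun i => \sum_k d k * a' k (tnth (in_tuple S) i)).
  under [RHS]eq_bigr => i _ do rewrite scaler_suml.
  rewrite exchange_big; apply: eq_bigr => k _; rewrite a'E scaler_sumr [LHS]big_tnth.
  by apply: eq_bigr => i _; rewrite scalerA.
have inj_S : injective (tnth (in_tuple S)) by apply/tuple_uniqP.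
(* [b] transported from positions in [S] to elements of [I], with value 0 elsewhere. *)
pose b' x := if [pick j in t | tnth (in_tuple S) j == x] is Some j then b j else 0.
have b'E j : j \in t -> b' (tnth (in_tuple S) j) = b j.
  move=> j_t; rewrite /b'; case: pickP => [k /andP[_ /eqP /inj_S -> //]|/(_ j)].
  by rewrite j_t eqxx.
rewrite -b'E //; apply: (indep (map (tnth (in_tuple S)) t)).
- by rewrite map_inj_uniq.
- rewrite big_map -[RHS]b0 !big_seq; apply: eq_bigr => j j_t.
  by rewrite b'E.
- exact: map_f.
Qed.

Section CoordinateTheory.
Variables (n : nat) (e : 'I_n -> V) (c : V -> 'I_n -> R).
Hypothesis c_coord : coordinates e c.

Lemma coordE v : v = \sum_i c v i *: e i. Proof. by case: c_coord => + _; apply. Qed.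
Lemma coord_sumK a : c (\sum_i a i *: e i) =1 a. Proof. by case: c_coord => _; apply. Qed.

Lemma coordD v w i : c (v + w) i = c v i + c w i.
Proof.
rewrite {1}[v]coordE {1}[w]coordE -big_split /=.
by under eq_bigr => j _ do rewrite -scalerDl; rewrite coord_sumK.
Qed.

Lemma coordZ r v i : c (r *: v) i = r * c v i.
Proof.
rewrite {1}[v]coordE scaler_sumr.
by under eq_bigr => j _ do rewrite scalerA; rewrite coord_sumK.
Qed.

Lemma coord0 i : c 0 i = 0.
Proof. by rewrite -(scale0r 0) coordZ mul0r. Qed.

Lemma coord_eq0 v : (forall i, c v i = 0) -> v = 0.
Proof. by move=> v0; rewrite [v]coordE big1 // => i _; rewrite v0 scale0r. Qed.

Lemma coord_indep (a : 'I_n -> R) : \sum_i a i *: e i = 0 -> forall i, a i = 0.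
Proof. by move=> a0 i; rewrite -(coord_sumK a) a0 coord0. Qed.

Lemma coord_basis k i : c (e k) i = (i == k)%:R.
Proof.
rewrite -(coord_sumK (fun i => (i == k)%:R)); congr (c _ i).
rewrite (bigD1 k) //= eqxx scale1r big1 ?addr0 // => j /negPf ->.
by rewrite scale0r.
Qed.

Definition semilinear_extension (s : R -> R) (g : 'I_n -> V) (v : V) :=
  \sum_i s (c v i) *: g i.

Lemma semilinear_extensionP (s : R -> R) (g : 'I_n -> V) :
  embedding s -> semilinear s (semilinear_extension s g).
Proof.
move=> s_emb; rewrite /semilinear_extension; split=> [v w|r v].
  rewrite -big_split; apply: eq_bigr => i _.
  by rewrite coordD (embeddingD s_emb) scalerDl.
rewrite scaler_sumr; apply: eq_bigr => i _.
by rewrite coordZ (embeddingM s_emb) scalerA.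
Qed.

Lemma semilinear_extension_basis (s : R -> R) (g : 'I_n -> V) k : embedding s ->
 semilinear_extension s g (e k) = g k.
Proof.
move=> s_emb; rewrite /semilinear_extension (bigD1 k) //= coord_basis eqxx.
rewrite (embedding1 s_emb) scale1r big1 ?addr0 // => i /negPf neq_ik.
by rewrite coord_basis neq_ik (embedding0 s_emb) scale0r.
Qed.

End CoordinateTheory.

Lemma semilinear0 (s : R -> R) (f : V -> V) : semilinear s f -> f 0 = 0.
Proof. by case=> fD _; apply: (@addrI _ (f 0)); rewrite -fD !addr0. Qed.

Lemma semilinear_sum (s : R -> R) (f : V -> V) (I : Type) (r : seq I) (P : pred I)
    (F : I -> V) :
  semilinear s f -> f (\sum_(i <- r | P i) F i) = \sum_(i <- r | P i) f (F i).
Proof. by move=> sf; case: (sf) => fD _; apply: (big_morph f fD (semilinear0 sf)). Qed.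

Lemma semilinearB (s : R -> R) (f : V -> V) v w : semilinear s f -> f (v - w) = f v - f w.
Proof. by case=> fD _; apply/eqP; rewrite eq_sym subr_eq -fD subrK. Qed.

Lemma semilinear_comp (s t : R -> R) (f g : V -> V) :
  semilinear s f -> semilinear t g -> semilinear (s \o t) (f \o g).
Proof.
by move=> [fD fZ] [gD gZ]; split=> [v w|r v] /=; rewrite ?gD ?fD ?gZ ?fZ.
Qed.

Lemma semilinear_ext n (e : 'I_n -> V) c (s t : R -> R) (f g : V -> V) :
    coordinates e c -> semilinear s f -> semilinear t g -> s =1 t ->
  (forall i, f (e i) = g (e i)) -> f =1 g.
Proof.
move=> ce sf sg st fg v; rewrite [v](coordE ce).
rewrite (semilinear_sum _ _ _ sf) (semilinear_sum _ _ _ sg); apply: eq_bigr => i _.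
by rewrite (proj2 sf) (proj2 sg) fg st.
Qed.

End Coordinates.
Section BaseChangeCoordinates.
Variables (R : idomainType) (M : lmodType R).
Variables (n : nat) (e : 'I_n -> M) (c : M -> 'I_n -> R).
Hypothesis ce : coordinates e c.

Definition bc_coord (v : base_change M) i := bc_form (c^~ i) v.

Lemma bc_coord_tensor x m i : bc_coord (tensor x m) i = x * (c m i)%:F.
Proof.
by apply: (@bc_form_tensor _ _ (c^~ i)) => [m' m''|r m'];
  rewrite ?(coordD ce) ?(coordZ ce).
Qed.

Lemma bc_coordinates : coordinates (fun i => tensor 1 (e i)) bc_coord.
Proof.
have cD i : {morph c^~ i : m m' / m + m'} by move=> m m'; apply: (coordD ce).
have cZ i r m : c (r *: m) i = r * c m i by apply: (coordZ ce).
split=> [v|a i].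
  elim/base_change_ind: v => [|v w IHv IHw|x m].
  - rewrite big1 // => i _.
    by rewrite -(scale0r 0) /bc_coord bc_formZ // mul0r !scale0r.
  - under eq_bigr => i _ do rewrite /bc_coord bc_formD // scalerDl.
    by rewrite big_split /= -IHv -IHw.
  - rewrite [in LHS](coordE ce m) tensor_sum; apply: eq_bigr => i _.
    by rewrite bc_coord_tensor tensorE tensorZr scalerA.
rewrite /bc_coord.
rewrite (big_morph (bc_form (c^~ i)) (bc_formD (cD i) (cZ i)) (id1 := 0)); last first.
  by rewrite -(scale0r 0) bc_formZ // mul0r.
rewrite (bigD1 i) //= big1 => [|j neq_ji];
  rewrite bc_formZ // bc_form_tensor // (coord_basis ce).
  by rewrite eqxx addr0 !mulr1.
by rewrite eq_sym (negPf neq_ji) tofrac0 !mulr0.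
Qed.

End BaseChangeCoordinates.

(** * Laurent series and p-adic powers of 1 + X *)

Section Laurent.
Variables (E : fieldType).

(** A nonzero denominator is a power of X times a unit, so inverting X alone already yields the
    fraction field. *)
Lemma laurent_Xsplit (x : laurent E) : exists n r, (fpsX ^+ n)%:F * x = r%:F.
Proof.
have [a [b [/fps_split[n [g [ug ->]]] ->]]] := fraction_split x.
have X0 : (fpsX ^+ n)%:F != 0 :> laurent E by rewrite tofrac_eq0 expf_neq0 // fpsX_neq0.
have g0 : g%:F != 0 by rewrite tofrac_eq0; apply: contraTneq ug => ->; rewrite unitr0.
exists n, (g^-1 * a); rewrite rmorphM mulrA -mulf_div divff // mul1r.
by apply: (mulIf g0); rewrite mulfVK // -rmorphM mulrAC mulVr // mul1r.
Qed.

Lemma base_change_Xsplit (M : lmodType {fps E}) (v : base_change M) :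
  exists n m, (fpsX ^+ n)%:F *: v = tensor 1 m.
Proof.
elim/base_change_ind: v => [|v w [n [m vE]] [n' [m' wE]]|x m].
- by exists 0%N, 0; rewrite scaler0 tensor0r.
- exists (n + n')%N, (fpsX ^+ n' *: m + fpsX ^+ n *: m').
  rewrite scalerDr exprD rmorphM -[_ *: w]scalerA wE mulrC -scalerA vE tensorDr.
  by rewrite !tensorZr.
- have [n [r xE]] := laurent_Xsplit x.
  by exists n, (r *: m); rewrite tensorE scalerA xE tensorZr.
Qed.

Variable p : nat.
Hypothesis charE : p \in [pchar E].

(** If d is a common denominator of the [h j], multiplying the relation by phi(d) brings it into
    E[[X]]. *)
Lemma sum_oneX_phi_laurent_eq0 (h : 'I_p -> laurent E) : embedding (@phi_fps E p) ->
    \sum_(j < p) ((1 + fpsX) ^+ j)%:F * phi_laurent p (h j) = 0 ->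
  forall j, h j = 0.
Proof.
move=> phi_emb h0 j; have [d [d0 [r rE]]] := common_denominator h.
have dF0 : d%:F != 0 :> laurent E by rewrite tofrac_eq0.
suff r0 : r j = 0.
  by apply/eqP; rewrite -(mulrI_eq0 _ (mulfI dF0)) rE r0 tofrac0.
move: j; apply: (sum_oneX_phi_eq0 charE); apply/eqP; rewrite -tofrac_eq0.
have <- : (phi_fps p d)%:F * (\sum_(j < p) ((1 + fpsX) ^+ j)%:F * phi_laurent p (h j)) =
    (\sum_(j < p) (1 + fpsX) ^+ j * phi_fps p (r j))%:F.
  rewrite mulr_sumr rmorph_sum; apply: eq_bigr => j _.
  rewrite mulrCA rmorphM; congr (_ * _); rewrite -[RHS]/((phi_fps p (r j))%:F).
  rewrite -!(frac_ext_tofrac phi_emb) -rE.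
  by rewrite (embeddingM (frac_ext_embedding phi_emb)).
by rewrite h0 mulr0.
Qed.

Lemma gamma_X (a : Gamma p) : gamma_fps a (fpsX : {fps E}) = oneX_pow E (val a) - 1.
Proof.
have pow0 m : ((1 + fpsX) ^+ m : {fps E}) 0%N = 1.
  by elim: m => // m IH; rewrite exprS fps_coef0M IH mulr1 /= addr0.
apply: fpsP => -[|i].
  by rewrite fps_coefB [LHS]/= big_ord1 mul0r [oneX_pow _ _ _]/= pow0 subrr.
rewrite [LHS]/= big_ord_recl mul0r add0r big_ord_recl mul1r expr1.
by rewrite big1 ?addr0 // => k _; rewrite mul0r.
Qed.

Lemma oneX_pow_approx (a : Zp p) N :
  exists h, oneX_pow E a = (1 + fpsX) ^+ `|a N|%N + fpsX ^+ (p ^ N) * h.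
Proof.
have [i lt_i|h hE] := @fps_dvdXn E (p ^ N) (oneX_pow E a - (1 + fpsX) ^+ `|a N|%N).
  by rewrite fps_coefB (@oneX_powE E p a N) ?subrr.
by exists h; rewrite -hE addrC subrK.
Qed.

(** If b is the inverse of a, then b a is 1 modulo p^(N+1), hence modulo p. Level 0 is excluded,
    since the representative modulo 1 is 0. *)
Lemma Gamma_ndvd (a : Gamma p) N : ~~ (p %| `|val a N.+1|)%N.
Proof.
have p_prime := pcharf_prime charE.
have /(congr1 (fun b : Zp p => b N.+1)) := Gamma_inv_valK a.
move: (Gamma_inv_val a) (val a) => b a' /= /eqP; rewrite eqz_mod_dvd => dv1.
apply/negP => dva; have {}dv1 : (p%:Z %| b N.+1 * a' N.+1 - 1)%Z.
  by apply: dvdz_trans dv1; rewrite dvdzE /= dvdn_exp.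
suff : (p%:Z %| 1)%Z by rewrite dvdzE /= dvdn1 => /eqP p1; rewrite p1 in p_prime.
by rewrite -[X in (_ %| X)%Z](subKr (b N.+1 * a' N.+1)) rpredB // dvdz_mull //.
Qed.

End Laurent.
(** * The Frobenius attached to psi *)

Section PsiGamma.
Variables (E : fieldType) (p : nat).
Hypothesis charE : p \in [pchar E].
Variables (M : lmodType {fps E}) (psi : M -> M) (act : Gamma p -> M -> M).
Hypothesis psiGammaM : psiGamma_module psi act.
Hypothesis psi_nondeg : psi_nondegenerate psi.
Variables (n : nat) (e : 'I_n -> M) (c : M -> 'I_n -> {fps E}).
Hypothesis ce : coordinates e c.
Variable i0 : 'I_n.

Local Notation K := (laurent E).
Local Notation D := (base_change M).
Local Notation phi := (@phi_fps E p).
Local Notation gam := (@gamma_fps E p).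
Local Notation u := (1 + fpsX : {fps E}).

Let psiD : {morph psi : y z / y + z} := psiGamma_psiD psiGammaM.
Let psiZ := psiGamma_psiZ psiGammaM.
Let psi_act := psiGamma_comm psiGammaM.
Let p_gt0 : (0 < p)%N := prime_gt0 (pcharf_prime charE).

Let act1 v : act 1%g v = v.
Proof. by case: (psiGamma_act psiGammaM). Qed.
Let actM a b v : act (a * b)%g v = act a (act b v).
Proof. by case: (psiGamma_act psiGammaM). Qed.
Let act_semilinear a : semilinear (gam a) (act a).
Proof. by case: (psiGamma_act psiGammaM). Qed.
Let actZ a r v : act a (r *: v) = gam a r *: act a v.
Proof. exact: (proj2 (act_semilinear a)). Qed.
Let actVK a v : act a (act a^-1%g v) = v.
Proof. by rewrite -actM mulgV act1. Qed.

Let actKV a v : act a^-1%g (act a v) = v.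
Proof. by rewrite -actM mulVg act1. Qed.

Lemma psi0 : psi 0 = 0.
Proof. by apply: (@addrI _ (psi 0)); rewrite -psiD !addr0. Qed.

Lemma coord_torsion_free (r : {fps E}) (y : M) : r != 0 -> r *: y = 0 -> y = 0.
Proof.
move=> r0 ry0; apply: (coord_eq0 ce) => i; apply/eqP.
by rewrite -(mulrI_eq0 _ (mulfI r0)) -(coordZ ce) ry0 (coord0 ce).
Qed.

Lemma scale_faithful (r r' : {fps E}) : (forall y : M, r *: y = r' *: y) -> r = r'.
Proof.
move=> rr'; have /(congr1 (c^~ i0)) := rr' (e i0).
by rewrite !(coordZ ce) (coord_basis ce) eqxx !mulr1.
Qed.

(** All E[[X]]-multiples of (r - r') y are killed by psi, so non-degeneracy gives (r - r') y = 0. *)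
Lemma psi_faithful (r r' : {fps E}) :
  (forall y : M, psi (r *: y) = psi (r' *: y)) -> r = r'.
Proof.
have psiN y : psi (- y) = - psi y.
  by apply: (@addrI _ (psi y)); rewrite -psiD !subrr psi0.
move=> rr'; apply: scale_faithful => y; apply/eqP; rewrite -subr_eq0; apply/eqP.
apply: psi_nondeg => f; rewrite scalerBr !scalerA ![f * _]mulrC -!scalerA.
by rewrite psiD psiN rr' subrr.
Qed.

(* The algebraic identities satisfied by [phi] and [gam] are read off from    *)
(* the module laws, because M is nonzero (it has the basis vector [e i0]) and *)
(* free, hence a faithful E[[X]]-module.                                      *)
Lemma phi_embedding : embedding phi.
Proof.
split; [exact: (phi_add charE)| |exact: (phi_1 charE)|exact: (phi_inj0 charE)].
move=> f g; apply: psi_faithful => y.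
by rewrite -(scalerA (phi f)) !psiZ scalerA.
Qed.

(** Scaling by [gam a r] is scaling by [r] conjugated by [act a]; the laws of the action thus become
    laws of [gam]. *)
Lemma act_conj_scale a r y : act a (r *: act a^-1%g y) = gam a r *: y.
Proof. by rewrite actZ actVK. Qed.

Lemma gamma_embedding a : embedding (gam a).
Proof.
split.
- move=> r s; apply: scale_faithful => y.
  by rewrite scalerDl -!act_conj_scale scalerDl (proj1 (act_semilinear a)).
- move=> r s; apply: scale_faithful => y.
  by rewrite -scalerA -!act_conj_scale -scalerA actKV.
- by apply: scale_faithful => y; rewrite -act_conj_scale !scale1r actVK.
- move=> r r0; apply: scale_faithful => y; rewrite scale0r.
  have /(congr1 (act a^-1%g)) : act a (r *: y) = 0 by rewrite actZ r0 scale0r.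
  by rewrite actKV (semilinear0 (act_semilinear _)).
Qed.

Lemma gamma1E r : gam 1%g r = r.
Proof. by apply: scale_faithful => y; rewrite -act_conj_scale invg1 !act1. Qed.

Lemma gammaME a b r : gam (a * b)%g r = gam a (gam b r).
Proof.
apply: scale_faithful => y; rewrite -act_conj_scale invgM !actM.
by rewrite act_conj_scale act_conj_scale.
Qed.

Lemma phi_gammaC a r : phi (gam a r) = gam a (phi r).
Proof.
apply: psi_faithful => y.
by rewrite psiZ -(actVK a y) -actZ !psi_act psiZ actZ psi_act.
Qed.

(** Both [gam a] and [gam a^-1] send X to a multiple of X; composing them makes the two cofactors
    cancel. *)
Lemma gamma_X_unit a : exists2 w, w \is a GRing.unit & gam a fpsX = fpsX * w.
Proof.
have Xdvd b : exists w, gam b fpsX = fpsX * w.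
  have [|w wE] := @fps_dvdXn E 1 (gam b fpsX); last by exists w; rewrite wE expr1.
  by move=> [|//] _; rewrite [LHS]/= big_ord1 mul0r.
have [w wE] := Xdvd a; have [w' w'E] := Xdvd a^-1%g.
exists w => //; apply/unitrPr; exists (gam a w').
apply: (mulfI (@fpsX_neq0 E)); rewrite mulr1 mulrA -wE -(embeddingM (gamma_embedding a)).
by rewrite -w'E -gammaME mulgV gamma1E.
Qed.

Lemma gamma_oneX a : gam a u = oneX_pow E (val a).
Proof.
have ge := gamma_embedding a.
by rewrite (embeddingD ge) (embedding1 ge) gamma_X addrC subrK.
Qed.

(* [psi_coord y i] is the i-th coordinate of (1 + X)^p times the linear map   *)
(* M -> E[[X]] (x)_phi M, y |-> \sum_j (1 + X)^j (x) psi((1 + X)^-j y); the   *)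
(* factor avoids negative powers.                                             *)
Definition psi_coord (y : M) (i : 'I_n) : {fps E} :=
  \sum_(j < p) u ^+ j * phi (c (psi (u ^+ (p - j) *: y)) i).

Lemma psi_coordD y z i : psi_coord (y + z) i = psi_coord y i + psi_coord z i.
Proof.
rewrite -big_split; apply: eq_bigr => j _.
by rewrite scalerDr psiD (coordD ce) (embeddingD phi_embedding) mulrDr.
Qed.

Lemma psi_coord0 i : psi_coord 0 i = 0.
Proof. by apply: (@addrI _ (psi_coord 0 i)); rewrite -psi_coordD !addr0. Qed.

Lemma psi_coord_phi r y i : psi_coord (phi r *: y) i = phi r * psi_coord y i.
Proof.
rewrite mulr_sumr; apply: eq_bigr => j _.
rewrite scalerA [_ * phi r]mulrC -scalerA psiZ (coordZ ce) (embeddingM phi_embedding).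
by rewrite mulrCA.
Qed.

(** Term j+1 on the left is u times term j of [psi_coord y i]. The sum wraps around: term 0 on the
    left matches term p-1, because psi(u^(p+1) y) = u psi(u y) and phi(u) = u^p. *)
Lemma psi_coord_oneX y i : psi_coord (u *: y) i = u * psi_coord y i.
Proof.
rewrite /psi_coord.
case: (p) p_gt0 (phi_oneX charE) psiZ (embeddingM phi_embedding)
  => // q _ phi_u psiZ' phiM.
rewrite big_ord_recl big_ord_recr /= mulrDr addrC mulr_sumr; congr (_ + _).
  apply: eq_bigr => j _; rewrite /= scalerA -exprSr /bump add1n subSS.
  by rewrite -(subSn (ltnW (ltn_ord j))) exprS mulrA.
by rewrite mul1r subn0 subSnn expr1 -phi_u psiZ' (coordZ ce) mulrA -exprS -phi_u phiM.
Qed.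

(** Linearity over the image of phi and under u, hence under X, suffices: every r is \sum_l X^l
    phi(h_l). *)
Lemma psi_coordZ r y i : psi_coord (r *: y) i = r * psi_coord y i.
Proof.
have coordX l z : psi_coord (fpsX ^+ l *: z) i = fpsX ^+ l * psi_coord z i.
  elim: l z => [|l IH] z; first by rewrite scale1r mul1r.
  rewrite exprSr -scalerA IH -mulrA; congr (_ * _).
  have := psi_coord_oneX z i; rewrite scalerDl scale1r psi_coordD mulrDl mul1r.
  exact: addrI.
have [h ->] := fps_Xphi_decomp charE r.
rewrite scaler_suml mulr_suml.
rewrite (big_morph (psi_coord^~ i) (fun y z => psi_coordD y z i) (psi_coord0 i)).
by apply: eq_bigr => l _; rewrite -scalerA coordX psi_coord_phi mulrA.
Qed.

(** By linearity f y also has zero image for each f; its j = 0 coefficient is psi(u^p f y) = u psi(f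
    y), so psi(f y) = 0. *)
Lemma psi_coord_inj0 y : (forall i, psi_coord y i = 0) -> y = 0.
Proof.
move=> y0; apply: psi_nondeg => f.
suff : u *: psi (f *: y) = 0 by apply/coord_torsion_free/fps_oneX_neq0.
rewrite -psiZ (phi_oneX charE); apply: (coord_eq0 ce) => i.
have fy0 : psi_coord (f *: y) i = 0 by rewrite psi_coordZ y0 mulr0.
by have := sum_oneX_phi_eq0 charE fy0 (Ordinal p_gt0); rewrite subn0.
Qed.

Definition psi_mx : 'M[{fps E}]_n := \matrix_(k, i) psi_coord (e k) i.
Local Notation Apsi := (map_mx (@FracField.tofrac _) psi_mx : 'M[K]_n).

Lemma psi_coordE y i : psi_coord y i = \sum_k c y k * psi_mx k i.
Proof.
rewrite {1}(coordE ce y).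
rewrite (big_morph (psi_coord^~ i) (fun y z => psi_coordD y z i) (psi_coord0 i)).
by apply: eq_bigr => k _; rewrite psi_coordZ mxE.
Qed.

(** A nonzero row vector in the kernel, cleared of denominators, would be the coordinates of a
    nonzero y contradicting [psi_coord_inj0]. *)
Lemma psi_mx_unit : Apsi \in unitmx.
Proof.
rewrite unitmxE unitfE; apply/negP => /det0P[v /eqP v0 vA]; apply: v0.
have [d [d0 [r rE]]] := common_denominator (v ord0).
suff r0 i : r i = 0.
  have dF0 : d%:F != 0 :> K by rewrite tofrac_eq0.
  by apply/rowP => i; apply: (mulfI dF0); rewrite rE r0 mxE mulr0.
suff y0 : \sum_k r k *: e k = 0 by apply: (coord_indep ce y0).
apply: psi_coord_inj0 => j; rewrite psi_coordE.
under eq_bigr => k _ do rewrite (coord_sumK ce).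
apply/eqP; rewrite -tofrac_eq0 rmorph_sum /=.
under eq_bigr => k _ do rewrite tofracM -rE -mulrA.
rewrite -mulr_sumr; have /rowP/(_ j) := vA; rewrite !mxE => vA0.
rewrite -[X in _ == X](mulr0 d%:F); apply/eqP; congr (_ * _); rewrite -[RHS]vA0.
by apply: eq_bigr => k _; rewrite [in RHS]mxE.
Qed.

Local Notation eD := (fun i => tensor 1 (e i) : D).
Local Notation cD := (bc_coord c).
Let ceD : coordinates eD cD := bc_coordinates ce.

(** Row i holds the coordinates of phi(1 (x) e_i). The factor u^p undoes the one built into
    [psi_coord]. *)
Definition phi_mx : 'M[K]_n := (u ^+ p)%:F *: invmx Apsi.

Definition bc_phi : D -> D :=
  semilinear_extension cD (@phi_laurent E p) (fun i => \sum_k phi_mx i k *: eD k).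

Let phiK_emb : embedding (@phi_laurent E p) := frac_ext_embedding phi_embedding.

Let uF0 : (u ^+ p)%:F != 0 :> K.
Proof. by rewrite tofrac_eq0 expf_neq0 // fps_oneX_neq0. Qed.

Lemma phi_mx_unit : phi_mx \in unitmx.
Proof. by rewrite unitmxZ ?unitfE // unitmx_inv psi_mx_unit. Qed.

Lemma bc_phi_semilinear : semilinear (@phi_laurent E p) bc_phi.
Proof. exact: (semilinear_extensionP ceD). Qed.

Lemma bc_phi_basis i : bc_phi (eD i) = \sum_k phi_mx i k *: eD k.
Proof. exact: (semilinear_extension_basis ceD). Qed.

Lemma phi_mx_indep (x : 'I_n -> K) :
  \sum_i x i *: bc_phi (eD i) = 0 -> forall i, x i = 0.
Proof.
move=> x0; suff : \row_i x i = 0 by move=> /rowP r0 i; have := r0 i; rewrite !mxE.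
rewrite -[LHS](mulmxK phi_mx_unit).
suff -> : \row_i x i *m phi_mx = 0 by rewrite mul0mx.
apply/rowP => k; rewrite !mxE; move: k.
apply: (coord_indep ceD); rewrite -[RHS]x0.
under eq_bigr => k _ do rewrite scaler_suml.
rewrite exchange_big; apply: eq_bigr => i _.
by rewrite bc_phi_basis scaler_sumr; apply: eq_bigr => k _; rewrite mxE scalerA.
Qed.

(** Grouped by the phi(1 (x) e_i), the left side has coordinate row c(y) [Apsi] [phi_mx], and [Apsi]
    [phi_mx] is the scalar u^p. *)
Lemma psi_expansion (y : M) :
  \sum_(j < p) (u ^+ j)%:F *: bc_phi (tensor 1 (psi (u ^+ (p - j) *: y))) =
  (u ^+ p)%:F *: tensor 1 y.
Proof.
transitivity (\sum_i (psi_coord y i)%:F *: bc_phi (eD i)).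
  under [RHS]eq_bigr => i _ do rewrite rmorph_sum scaler_suml.
  rewrite exchange_big; apply: eq_bigr => j _.
  rewrite /bc_phi /semilinear_extension scaler_sumr.
  apply: eq_bigr => i _; rewrite scalerA.
  rewrite -/(semilinear_extension _ _ _ _) -/bc_phi bc_phi_basis.
  congr (_ *: _); rewrite (bc_coord_tensor ce) mul1r.
  rewrite [phi_laurent _ _](frac_ext_tofrac phi_embedding).
  by rewrite rmorphM.
under eq_bigr => i _ do rewrite bc_phi_basis scaler_sumr.
rewrite exchange_big [in RHS](coordE ce y) tensor_sum scaler_sumr.
apply: eq_bigr => k _; under eq_bigr => i _ do rewrite scalerA.
rewrite -scaler_suml tensorZr scalerA; congr (_ *: _).
under eq_bigr => i _ do rewrite psi_coordE rmorph_sum mulr_suml.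
rewrite exchange_big /=.
transitivity ((\row_l (c y l)%:F *m (Apsi *m phi_mx)) ord0 k).
  rewrite mxE; apply: eq_bigr => l _; rewrite !mxE mulr_sumr.
  by apply: eq_bigr => i _; rewrite rmorphM !mxE -!mulrA.
by rewrite -scalemxAr mulmxV ?psi_mx_unit // -scalemxAr mulmx1 !mxE.
Qed.

(** The phi(1 (x) e_i) are independent, so the relation splits into one scalar relation per
    coordinate. *)
Lemma bc_phi_uniq (z : 'I_p -> D) :
  \sum_(j < p) (u ^+ j)%:F *: bc_phi (z j) = 0 -> forall j, z j = 0.
Proof.
move=> z0 j; apply: (coord_eq0 ceD) => i; move: j.
apply: (sum_oneX_phi_laurent_eq0 charE phi_embedding); move: i; apply: phi_mx_indep.
rewrite -[RHS]z0; under eq_bigr => i _ do rewrite scaler_suml.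
rewrite exchange_big; apply: eq_bigr => j _; rewrite [in RHS](coordE ceD (z j)).
rewrite (semilinear_sum _ _ _ bc_phi_semilinear) scaler_sumr.
by apply: eq_bigr => i _; rewrite (proj2 bc_phi_semilinear) scalerA.
Qed.

Lemma tensor1_inj0 (m : M) : tensor 1 m = 0 -> m = 0.
Proof.
move=> m0; apply: (coord_eq0 ce) => i; apply/eqP.
by rewrite -tofrac_eq0 -[X in X == 0]mul1r -(bc_coord_tensor ce) m0 (coord0 ceD).
Qed.

Let bc_phiB x y : bc_phi (x - y) = bc_phi x - bc_phi y.
Proof. exact: semilinearB bc_phi_semilinear. Qed.

Lemma psi_of_bc_phi y : psi_of p bc_phi (tensor 1 y) = tensor 1 (psi y).
Proof.
(* This is psi(u^-j y): phi turns the factor u^-1 into u^-p, which absorbs the u^p of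
   [psi_expansion]. At j = 0 it is psi(y). *)
pose ys j : D := (u%:F)^-1 *: tensor 1 (psi (u ^+ (p - j) *: y)).
have uF : u%:F != 0 :> K by rewrite tofrac_eq0 fps_oneX_neq0.
have phi_u : phi_laurent p u%:F = (u ^+ p)%:F.
  by rewrite [LHS](frac_ext_tofrac phi_embedding) (phi_oneX charE).
have ysP : tensor 1 y = \sum_(j < p) (u ^+ j)%:F *: bc_phi (ys j).
  apply: (can_inj (scalerK uF0)); rewrite -psi_expansion scaler_sumr.
  apply: eq_bigr => j _; rewrite scalerA mulrC -scalerA; congr (_ *: _).
  by rewrite -phi_u -(proj2 bc_phi_semilinear) /ys scalerA divff // scale1r.
rewrite /psi_of; case: xgetP => [ys' _ ys'P|no]; last by case: (no ys).
have ys'E : \sum_(j < p) (u ^+ j)%:F *: bc_phi (ys' j - ys j) = 0.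
  under eq_bigr => j _ do rewrite bc_phiB scalerBr.
  by rewrite sumrB -ys'P -ysP subrr.
have /eqP := bc_phi_uniq ys'E (Ordinal p_gt0); rewrite subr_eq0 => /eqP -> /=.
by rewrite /ys subn0 -(phi_oneX charE) psiZ tensorZr scalerA mulVf ?scale1r.
Qed.

(** * The action of Gamma *)

Definition bc_act a : D -> D :=
  semilinear_extension cD (gamma_laurent a) (fun i => tensor 1 (act a (e i))).

Let gamK_emb a : embedding (@gamma_laurent E p a) :=
  frac_ext_embedding (gamma_embedding a).

Lemma bc_act_semilinear a : semilinear (@gamma_laurent E p a) (bc_act a).
Proof. exact: (semilinear_extensionP ceD). Qed.

Lemma bc_act_tensor a m : bc_act a (tensor 1 m) = tensor 1 (act a m).
Proof.
rewrite [in RHS](coordE ce m) (semilinear_sum _ _ _ (act_semilinear a)) tensor_sum.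
apply: eq_bigr => i _; rewrite actZ tensorZr (bc_coord_tensor ce) mul1r.
by rewrite [gamma_laurent _ _](frac_ext_tofrac (gamma_embedding a)).
Qed.

Lemma bc_act1 v : bc_act 1%g v = v.
Proof.
have id_sl : semilinear id (@id D) by split.
apply: (semilinear_ext ceD (bc_act_semilinear _) id_sl) => [x|i].
  have [r [d [d0 ->]]] := fraction_split x.
  by rewrite [LHS](frac_extE (gamma_embedding _)) // !gamma1E.
by rewrite bc_act_tensor act1.
Qed.

Lemma bc_actM a b v : bc_act (a * b)%g v = bc_act a (bc_act b v).
Proof.
apply: (semilinear_ext ceD (bc_act_semilinear _)
  (semilinear_comp (bc_act_semilinear a) (bc_act_semilinear b))) => [x|i].
  have [r [d [d0 ->]]] := fraction_split x.
  rewrite /= /gamma_laurent !(frac_extE (gamma_embedding _)) ?gammaME //.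
  by rewrite (embedding_neq0 (gamma_embedding b)).
by rewrite /= !bc_act_tensor actM.
Qed.

(** * Commutation of phi with Gamma *)

Definition psi_lift (m w : M) :=
  psi w = m /\ forall k, (0 < k < p)%N -> psi (u ^+ k *: w) = 0.

(** Compare the expansion of u^p w with u^p phi(m) = phi(u m): by uniqueness the j = 0 coefficient
    is u m and the others vanish. *)
Lemma bc_phi_psi_lift m w : bc_phi (tensor 1 m) = tensor 1 w <-> psi_lift m w.
Proof.
have u_psi : psi (u ^+ p *: w) = u *: psi w by rewrite -(phi_oneX charE) psiZ.
have phi_um : (u ^+ p)%:F *: bc_phi (tensor 1 m) = bc_phi (tensor 1 (u *: m)).
  rewrite tensorZr (proj2 bc_phi_semilinear).
  rewrite [phi_laurent _ _](frac_ext_tofrac phi_embedding).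
  by rewrite (phi_oneX charE).
have bc_phi0 : bc_phi 0 = 0 := semilinear0 bc_phi_semilinear.
split=> [mw|[psiw w0]]; last first.
  apply: (can_inj (scalerK uF0)); rewrite phi_um -psi_expansion.
  rewrite (bigD1 (Ordinal p_gt0)) //= subn0 u_psi psiw scale1r big1 ?addr0 // => j.
  rewrite -val_eqE /= -lt0n => j0; rewrite w0 ?tensor0r ?bc_phi0 ?scaler0 //.
  by rewrite subn_gt0 ltn_ord ltn_subrL j0.
pose z (j : 'I_p) : D :=
  tensor 1 (psi (u ^+ (p - j) *: w)) - (if j == 0%N :> nat then tensor 1 (u *: m) else 0).
have z0 j : z j = 0.
  apply: bc_phi_uniq; rewrite /z; under eq_bigr => i _ do rewrite bc_phiB scalerBr.
  rewrite sumrB psi_expansion -mw phi_um (bigD1 (Ordinal p_gt0)) //= big1; last first.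
    by move=> i; rewrite -val_eqE /= => /negPf ->; rewrite bc_phi0 scaler0.
  by rewrite addr0 scale1r subrr.
split=> [|k /andP[k0 kp]].
  have := z0 (Ordinal p_gt0); rewrite /z /= subn0 u_psi -tensorBr -scalerBr.
  move=> /tensor1_inj0 /(coord_torsion_free (fps_oneX_neq0 E)) /eqP.
  by rewrite subr_eq0 => /eqP.
have kj : (p - k < p)%N by rewrite ltn_subrL k0.
have := z0 (Ordinal kj); rewrite /z /= subKn ?(ltnW kp) // subn_eq0 leqNgt kp /= subr0.
exact: tensor1_inj0.
Qed.

(** Write k = q p + r with 0 < r < p; the factor u^(q p) = phi(u^q) comes out of psi. *)
Lemma psi_lift_ndvd m w k : psi_lift m w -> ~~ (p %| k)%N -> psi (u ^+ k *: w) = 0.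
Proof.
move=> [_ w0] ndv; rewrite (divn_eq k p) exprD mulnC exprM -(phi_oneX charE).
rewrite -(embeddingX phi_embedding) -scalerA psiZ w0 ?scaler0 //.
by rewrite ltn_pmod // lt0n andbT.
Qed.

(* gam_(a^-1) (1 + X) = (1 + X)^(a^-1) is X-adically a limit of powers of     *)
(* 1 + X with exponent prime to p, and psi is X-adically continuous.          *)
Lemma psi_lift_act a m w : psi_lift m w -> psi_lift (act a m) (act a w).
Proof.
move=> mw; split=> [|k /andP[k0 kp]]; first by rewrite psi_act (proj1 mw).
(* Moves [act a] outside psi, which turns u^k into its image under a^-1. *)
rewrite -[u ^+ k *: _](actVK a) actZ actKV psi_act.
rewrite (embeddingX (gamma_embedding _)) gamma_oneX.
set b := a^-1%g; set y := psi _.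
suff -> : y = 0 by rewrite (semilinear0 (act_semilinear a)).
apply: (coord_eq0 ce) => i; apply: fps_dvdXn_eq0 => N.
have [h bE] := oneX_pow_approx charE (val b) N.+1.
have [h' bkE] : exists h', oneX_pow E (val b) ^+ k =
    (u ^+ `|val b N.+1|%N) ^+ k + fpsX ^+ (p ^ N.+1) * h'.
  (* The cofactor of x - y in x^k - y^k. *)
  exists (h * \sum_(i < k)
    oneX_pow E (val b) ^+ (k.-1 - i) * (u ^+ `|val b N.+1|%N) ^+ i).
  rewrite mulrA (_ : fpsX ^+ _ * h = oneX_pow E (val b) - u ^+ `|val b N.+1|%N).
    by rewrite -subrXX addrC subrK.
  by rewrite bE addrC addKr.
(* The main term has exponent prime to p and is killed. In the error term X^(p^(N+1)) = phi(X^(p^N))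
   leaves psi as X^(p^N). *)
have yE : y = fpsX ^+ (p ^ N) *: psi (h' *: w).
  rewrite /y bkE scalerDl psiD -exprM (psi_lift_ndvd mw) ?add0r; last first.
    by rewrite Euclid_dvdM ?(pcharf_prime charE) // negb_or (Gamma_ndvd charE) gtnNdvd.
  rewrite -scalerA expnS exprM -(phi_X charE) -(embeddingX phi_embedding).
  exact: psiZ.
have leN : (N <= p ^ N)%N.
  by rewrite ltnW // ltn_expl // prime_gt1 // (pcharf_prime charE).
by eexists; rewrite yE (coordZ ce) -{1}(subnKC leN) exprD -mulrA.
Qed.

(** phi(e_i) may lie outside M, but for large k both m = X^k e_i and phi(m) = X^(p k) phi(e_i) lie
    in M; the nonzero scalar is cancelled at the end. *)
Lemma bc_phi_actC a v : bc_phi (bc_act a v) = bc_act a (bc_phi v).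
Proof.
have phi_gamK (x : K) :
    phi_laurent p (gamma_laurent a x) = gamma_laurent a (phi_laurent p x).
  exact: (frac_ext_comp phi_embedding (gamma_embedding a) (gamma_embedding a)
    phi_embedding (phi_gammaC a) x).
apply: (semilinear_ext ceD (semilinear_comp bc_phi_semilinear (bc_act_semilinear a))
  (semilinear_comp (bc_act_semilinear a) bc_phi_semilinear)) => [//|i /=].
have [k [w wE]] := base_change_Xsplit (bc_phi (eD i)).
have kpk : (k <= p * k)%N by rewrite leq_pmull.
pose m := fpsX ^+ k *: e i.
have lift_m : bc_phi (tensor 1 m) = tensor 1 (fpsX ^+ (p * k - k) *: w).
  rewrite tensorZr (proj2 bc_phi_semilinear).
  rewrite [phi_laurent _ _](frac_ext_tofrac phi_embedding).
  rewrite (embeddingX phi_embedding) (phi_X charE) -exprM -{1}(subnK kpk) exprD.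
  by rewrite rmorphM -scalerA wE tensorZr.
have /bc_phi_psi_lift/(psi_lift_act a)/bc_phi_psi_lift := lift_m.
rewrite -!bc_act_tensor -lift_m tensorZr.
rewrite !(proj2 bc_phi_semilinear, proj2 (bc_act_semilinear a)).
rewrite phi_gamK; apply: can_inj; apply: scalerK.
apply: (embedding_neq0 (gamK_emb a)); apply: (embedding_neq0 phiK_emb).
by rewrite tofrac_eq0 expf_neq0 // fpsX_neq0.
Qed.

(** * Continuity of the action on D *)

Lemma Zp_eq_le (a b : Zp p) k l : (k <= l)%N -> a l = b l -> a k = b k.
Proof.
move=> le_kl; rewrite -(subnKC le_kl); elim: (l - k)%N => [|i IH]; first by rewrite addn0.
by rewrite addnS => ab; apply: IH; rewrite -(Zp_compat a) -(Zp_compat b) ab.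
Qed.

(** Read off from continuity on M at v and X^k v, where a v = e_i0: ([gam a] X^k - [gam b] X^k) e_i0
    = [gam b] X^k (b v - a v) - (b (X^k v) - a (X^k v)). *)
Lemma gamma_X_continuous (a : Gamma p) k N :
  exists l, forall b : Gamma p, val b l = val a l ->
  exists h, gam a (fpsX ^+ k) - gam b (fpsX ^+ k) = fpsX ^+ N * h.
Proof.
pose v := act a^-1%g (e i0).
have Xadic0 j (w : M) : Xadic j (w - w) by exists 0; rewrite subrr scaler0.
have [l1 [j1 cont1]] := psiGamma_cont psiGammaM a v N.
have [l2 [j2 cont2]] := psiGamma_cont psiGammaM a (fpsX ^+ k *: v) N.
exists (maxn l1 l2) => b ba.
have [y1 y1E] := cont1 b v (Zp_eq_le (leq_maxl _ _) ba) (Xadic0 _ _).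
have [y2 y2E] := cont2 b _ (Zp_eq_le (leq_maxr _ _) ba) (Xadic0 _ _).
exists (c (gam b (fpsX ^+ k) *: y1 - y2) i0); rewrite -(coordZ ce) scalerBr -y2E.
rewrite scalerA mulrC -scalerA -y1E !actZ actVK scalerBr opprB.
rewrite [X in c X _]addrC addrA subrK -scalerBl.
by rewrite (coordZ ce) (coord_basis ce) eqxx mulr1.
Qed.

Lemma uniform_exponent (I : finType) (P : nat -> I -> Prop) :
    (forall i k l, (k <= l)%N -> P k i -> P l i) -> (forall i, exists k, P k i) ->
  exists k, forall i, P k i.
Proof.
move=> mono /choice[k kP]; exists (\max_i k i) => i.
exact: mono (leq_bigmax i) (kP i).
Qed.

(** Together with [lattice_nbhs_sup]: any basis of D defines the same topology as M, up to a shift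
    of exponents. *)
Lemma lattice_nbhs_sub m (f : 'I_m -> D) : exists d, forall j v,
  lattice_nbhs f (d + j) v -> exists y, v = (fpsX ^+ j)%:F *: tensor 1 y.
Proof.
have [|i|d /choice[y yE]] := @uniform_exponent 'I_m
    (fun d i => exists y, (fpsX ^+ d)%:F *: f i = tensor 1 y).
- move=> i k l le_kl [y yE]; exists (fpsX ^+ (l - k) *: y).
  by rewrite -{1}(subnK le_kl) exprD rmorphM -scalerA yE tensorZr.
- exact: base_change_Xsplit.
exists d => j v [r ->]; exists (\sum_i r i *: y i).
rewrite tensor_sum scaler_sumr; apply: eq_bigr => i _.
rewrite tensorZr -yE !scalerA -!rmorphM; congr (_%:F *: _).
by rewrite exprD -mulrA mulrCA -mulrA [X in _ * X]mulrC.
Qed.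

Lemma lattice_nbhs_sup m (f : 'I_m -> D) : is_basis f -> exists d, forall j y,
  lattice_nbhs f j ((fpsX ^+ (d + j))%:F *: tensor 1 y).
Proof.
move=> /is_basis_coordinates[cf cfE].
have [|ki|d dP] := @uniform_exponent ('I_n * 'I_m)%type
    (fun d ki => exists r, (fpsX ^+ d)%:F * cf (eD ki.1) ki.2 = r%:F).
- move=> ki k l le_kl [r rE]; exists (fpsX ^+ (l - k) * r).
  by rewrite -{1}(subnK le_kl) exprD rmorphM -mulrA rE rmorphM.
- exact: laurent_Xsplit.
have /choice[r rE] := dP; exists d => j y.
exists (fun i => \sum_k c y k * r (k, i)).
rewrite [in LHS](coordE ce y) tensor_sum scaler_sumr.
under [RHS]eq_bigr => i _ do rewrite mulr_sumr rmorph_sum scaler_suml.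
rewrite exchange_big; apply: eq_bigr => k _.
rewrite tensorZr [tensor 1 (e k)](coordE cfE) !scaler_sumr; apply: eq_bigr => i _.
rewrite !scalerA; congr (_ *: _); rewrite /= !rmorphM /= -rE exprD rmorphM /=.
rewrite -!mulrA mulrCA; congr (_ * _).
by rewrite mulrCA.
Qed.

(** With X^q v = m0 and X^q w = w0 in M, [gam b] X^q (b w - a v) = (b w0 - a m0) + ([gam a] X^q -
    [gam b] X^q) a v. Both terms are small, and [gam b] X^q is X^q times a unit. *)
Lemma bc_act_continuous m (f : 'I_m -> D) :
  is_basis f -> continuous_action (lattice_nbhs f) bc_act.
Proof.
move=> f_basis a v N.
have [d1 sub1] := lattice_nbhs_sub f; have [d2 sup2] := lattice_nbhs_sup f_basis.
have [q [m0 vE]] := base_change_Xsplit v.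
have [q' [m1 v1E]] := base_change_Xsplit (bc_act a v).
(* q pays for dividing by [gam b] X^q, d2 for passing to the lattice of [f], and q' for the
   denominator of a v. *)
have [l1 gam_cont] := gamma_X_continuous a q (q + (d2 + N) + q').
have [l2 [j2 act_cont]] := psiGamma_cont psiGammaM a m0 (q + (d2 + N)).
exists (maxn l1 l2), (d1 + j2)%N => b w ba /sub1[y wvE].
have [h hE] := gam_cont b (Zp_eq_le (leq_maxl _ _) ba).
pose w0 := m0 + fpsX ^+ j2 *: (fpsX ^+ q *: y).
have w0E : (fpsX ^+ q)%:F *: w = tensor 1 w0.
  rewrite -[w](subrK v) wvE scalerDr vE tensorDr addrC !tensorZr !scalerA.
  by rewrite [X in _ + X *: _ = _]mulrC.
have [|y1 y1E] := act_cont b w0 (Zp_eq_le (leq_maxr _ _) ba).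
  by exists (fpsX ^+ q *: y); rewrite /w0 addrAC subrr add0r.
have [g ug gE] := gamma_X_unit b.
suff -> : bc_act b w - bc_act a v =
    (fpsX ^+ (d2 + N))%:F *: tensor 1 (g ^- q *: (y1 + h *: m1)) by apply: sup2.
have gXq : gam b (fpsX ^+ q) = fpsX ^+ q * g ^+ q.
  by rewrite (embeddingX (gamma_embedding b)) gE exprMn.
have gq0 : (gam b (fpsX ^+ q))%:F != 0 :> K.
  by rewrite tofrac_eq0 (embedding_neq0 (gamma_embedding b)) // expf_neq0 // fpsX_neq0.
apply: (can_inj (scalerK gq0)).
have gam_act d z : (gam d (fpsX ^+ q))%:F *: bc_act d z = bc_act d ((fpsX ^+ q)%:F *: z).
  rewrite (proj2 (bc_act_semilinear d)).
  by rewrite [gamma_laurent _ _](frac_ext_tofrac (gamma_embedding d)).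
transitivity ((fpsX ^+ (q + (d2 + N)))%:F *: tensor 1 (y1 + h *: m1)); last first.
  rewrite gXq -!tensorZr !scalerA; congr (tensor 1 (_ *: _)).
  by rewrite [X in _ = X / _]mulrAC mulrK ?unitrX // -exprD.
rewrite scalerBr gam_act w0E bc_act_tensor.
have -> : (gam b (fpsX ^+ q))%:F *: bc_act a v =
    tensor 1 (act a m0) - (gam a (fpsX ^+ q) - gam b (fpsX ^+ q))%:F *: bc_act a v.
  by rewrite rmorphB scalerBl gam_act vE bc_act_tensor subKr.
rewrite hE exprD -mulrA [_ * h]mulrC 2!rmorphM -!scalerA v1E opprB addrCA -tensorBr y1E.
by rewrite -!tensorZr -tensorDr addrC scalerDr.
Qed.

Lemma bc_phiGamma_module : phiGamma_module bc_phi bc_act.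
Proof.
have eD_basis : is_basis eD by apply/is_basis_coordinates; exists cD.
split.
- by exists n, eD.
- exact: bc_phi_semilinear.
(* [matrix_of] puts images in columns, [phi_mx] in rows. *)
- exists n, eD, phi_mx^T; split; rewrite ?unitmx_tr ?phi_mx_unit //.
  by move=> j; rewrite bc_phi_basis; apply: eq_bigr => i _; rewrite [phi_mx^T _ _]mxE.
- by split; [exact: bc_act1|exact: bc_actM|exact: bc_act_semilinear].
- exact: bc_act_continuous.
- exact: bc_phi_actC.
Qed.

End PsiGamma.

(** * Rank zero and conclusion *)

Lemma zero_phiGamma_module (E : fieldType) (p : nat) (D : lmodType (laurent E)) :
    (forall v w : D, v = w) ->
  phiGamma_module (fun v : D => v) (fun (_ : Gamma p) (v : D) => v).
Proof.
pose e0 (_ : 'I_0) : D := 0.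
move=> D0; have e0_basis : is_basis e0.
  apply/is_basis_coordinates; exists (fun _ _ => 0).
  by split=> [v|a [m //]]; apply: D0.
split=> //.
- by exists 0%N, e0.
- by split=> [v w|r v]; apply: D0.
- by exists 0%N, e0, 1%:M; split; rewrite ?unitmx1 // => -[m //].
- by split=> // a; split=> [v w|r v]; apply: D0.
- by move=> n e _ a v N; exists 0%N, 0%N => b w _ _; exists (fun=> 0); apply: D0.
Qed.

Theorem theorem1p6 (E : fieldType) (p : nat) (charE : p \in [pchar E]%R)
    (M : lmodType {fps E}) (psi : M -> M) (act : Gamma p -> M -> M)
    (psiGammaM : psiGamma_module psi act)
    (psi_surj : psi_surjective psi)
    (psi_nondeg : psi_nondegenerate psi)
    (M_free : is_free M) :
  exists (phiD : base_change M -> base_change M)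
         (actD : Gamma p -> base_change M -> base_change M),
    phiGamma_module phiD actD /\ compatible psi act phiD actD.
Proof.
(* Rank 0 is treated apart: the faithfulness arguments rely on a basis vector [e i0]. *)
have [[|n] [e [c ce]]] := free_coordinates M_free (psiGamma_fg psiGammaM).
  have D0 (v w : base_change M) : v = w.
    by rewrite [v](coordE (bc_coordinates ce)) [w](coordE (bc_coordinates ce)) !big_ord0.
  exists (fun v => v), (fun _ v => v); split; first exact: zero_phiGamma_module.
  by split=> *; apply: D0.
exists (bc_phi p psi e c), (bc_act act e c); split.
  exact: (bc_phiGamma_module charE psiGammaM psi_nondeg ce ord0).
split=> [a y|y]; first exact: (bc_act_tensor psiGammaM ce ord0).
exact: (psi_of_bc_phi charE psiGammaM psi_nondeg ce ord0).
Qed.
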